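(* Let $n\geq 1$ and equip $\mathbb{R}^{2n+1}$ with its standard contact structure $\xi_0=\ker\alpha_0$. Let $(f_t)_{t\in[0,1]}$ be a smooth path of contactomorphisms of $(\mathbb{R}^{2n+1},\xi_0)$ that is positive on the complement of some compact subset $K_1$, i.e. $\alpha_0(X_t^f)>0$ on $\mathbb{R}^{2n+1}\setminus K_1$ for all $t\in[0,1]$. Then there exist a positive path of diffeomorphisms $(g_t)_{t\in[0,1]}$ of $\mathbb{R}^{2n+1}$ with $g_0=f_0$ and $g_1=f_1$, and a compact subset $K_2\supset K_1$, such that $g_t$ coincides with $f_t$ on $\mathbb{R}^{2n+1}\setminus K_2$ for all $t\in[0,1]$.
   Context: The standard contact structure on $\mathbb{R}^{2n+1}$ with coordinates $(x_1,\dots,x_n,y_1,\dots,y_n,z)$ is $\xi_0=\ker\alpha_0$ with $\alpha_0=dz+\sum_{i=1}^n x_i\,dy_i$, cooriented by $\alpha_0$. A contactomorphism is a diffeomorphism preserving the contact structure; contactomorphisms are considered in the group $\mathrm{Cont}_0$ of contactomorphisms connected to the identity through contactomorphisms. A smooth path of diffeomorphisms $(f_t)_{t\in[0,1]}$ of a manifold $M$ is a family of diffeomorphisms such that $(t,p)\mapsto f_t(p)$ is smooth as a map $[0,1]\times M\to M$; all paths are smooth in this sense. It generates the time-dependent vector field $X_t^f$ determined by $\frac{d}{dt}f_t(p)=X_t^f(f_t(p))$. Given a cooriented contact structure $\xi=\ker\alpha$, the path is called positive if $\alpha(X_t^f)>0$ everywhere on $M$ for all $t$. *)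

(* Defs.v *)
From HB Require Import structures.
From mathcomp Require Import all_boot all_order all_algebra.
From mathcomp Require Import all_classical all_reals all_analysis.
Set Implicit Arguments.
Unset Strict Implicit.
Unset Printing Implicit Defensive.
Import Order.TTheory GRing.Theory Num.Theory numFieldNormedType.Exports.
Local Open Scope classical_set_scope.
Local Open Scope ring_scope.

(* Only used for open [U] and finite-dimensional [V]; there it says that all
   iterated partial derivatives of order at most [k] exist and are continuous
   on [U]. *)
Fixpoint Ck_on (R : realType) (V W : normedModType R) (k : nat)
    (U : set V) (f : V -> W) : Prop :=
  match k with
  | 0%N => forall x, U x -> {for x, continuous f}
  | k'.+1 => (forall x, U x -> differentiable f x) /\
             forall v : V, Ck_on k' U (fun x => 'D_v f x)
  end.

(* Smoothness on an arbitrary subset [A], such as [0, 1] x R^m: near each point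
   of [A] the map extends to a C^oo map on an open set. *)
Definition smooth_on (R : realType) (V W : normedModType R)
    (A : set V) (f : V -> W) : Prop :=
  forall a, A a -> exists (U : set V) (F : V -> W),
    [/\ open U, U a, forall k, Ck_on k U F & {in A `&` U, F =1 f}].

(* R^(2n+1); the coordinates are listed in the order x_1..x_n, y_1..y_n, z. *)
Notation Rstd R n := 'rV[R]_(n + n).+1.

Definition ix (n : nat) (i : 'I_n) : 'I_(n + n).+1 :=
  widen_ord (leqnSn _) (lshift n i).
Definition iy (n : nat) (i : 'I_n) : 'I_(n + n).+1 :=
  widen_ord (leqnSn _) (rshift n i).
Definition iz (n : nat) : 'I_(n + n).+1 := ord_max.

Definition alpha0 (R : realType) (n : nat) (p v : Rstd R n) : R :=
  v ord0 (iz n) + \sum_(i < n) p ord0 (ix i) * v ord0 (iy i).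

Definition xi0 (R : realType) (n : nat) (p : Rstd R n) : set (Rstd R n) :=
  [set v | alpha0 p v = 0].

Definition diffeomorphism (R : realType) (n : nat)
    (phi : Rstd R n -> Rstd R n) : Prop :=
  exists psi : Rstd R n -> Rstd R n,
    [/\ cancel phi psi, cancel psi phi,
        smooth_on setT phi & smooth_on setT psi].

Definition contactomorphism (R : realType) (n : nat)
    (phi : Rstd R n -> Rstd R n) : Prop :=
  diffeomorphism phi /\
  forall p, ('d phi p : Rstd R n -> Rstd R n) @` xi0 p = xi0 (phi p).

(* A path [f] is a function on all of R, of which only the restriction to
   [0, 1] is meaningful. *)
Definition diffeo_path (R : realType) (n : nat)
    (f : R -> Rstd R n -> Rstd R n) : Prop :=
  smooth_on [set tp : R * Rstd R n | tp.1 \in `[0, 1]]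
    (fun tp : R * Rstd R n => f tp.1 tp.2) /\
  forall t : R, t \in `[0, 1] -> diffeomorphism (f t).

Definition Cont0 (R : realType) (n : nat)
    (phi : Rstd R n -> Rstd R n) : Prop :=
  exists h : R -> Rstd R n -> Rstd R n,
    [/\ diffeo_path h, forall t : R, t \in `[0, 1] -> contactomorphism (h t),
        h 0 = id & h 1 = phi].

Definition contact_path (R : realType) (n : nat)
    (f : R -> Rstd R n -> Rstd R n) : Prop :=
  diffeo_path f /\ forall t : R, t \in `[0, 1] -> Cont0 (f t).

(* d/dt f_t(p) = X_t(f_t(p)) on [0, 1], the derivative being one-sided at the
   endpoints. *)
Definition generates (R : realType) (n : nat)
    (f X : R -> Rstd R n -> Rstd R n) : Prop :=
  forall (t : R) p, t \in `[0, 1] ->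
    (s - t)^-1 *: (f s p - f t p) @[s --> within `[0, 1]%classic t^']
      --> X t (f t p).

(* For a path of diffeomorphisms, [X] exists and is unique for [t] in [0, 1]. *)
Definition positive_on (R : realType) (n : nat) (A : set (Rstd R n))
    (f : R -> Rstd R n -> Rstd R n) : Prop :=
  exists2 X : R -> Rstd R n -> Rstd R n, generates f X &
    forall (t : R) q, t \in `[0, 1] -> A q -> 0 < alpha0 q (X t q).

(* Main.v *)
Require Import Defs.
From HB Require Import structures.
From mathcomp Require Import all_boot all_order all_algebra.
From mathcomp Require Import all_classical all_reals all_analysis.
From mathcomp Require Import ring lra.
Set Implicit Arguments.
Unset Strict Implicit.
Unset Printing Implicit Defensive.
Import Order.TTheory GRing.Theory Num.Theory numFieldNormedType.Exports.
Local Open Scope classical_set_scope.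
Local Open Scope ring_scope.

(** The path is corrected on the right, [g_t = f_t o phi_t], where [phi] is a
    compactly supported loop of diffeomorphisms based at the identity. Since
    [f_t] is a contactomorphism, [f_t^* alpha0 = lambda_t alpha0], so that at
    the point [g_t p]
      [alpha0 (X^g_t) = alpha0 (X^f_t) + lambda_t (phi_t p) * alpha0 (d/dt phi_t p)].
    The factor [lambda_t] is positive because [f_t] is joined to the identity by
    contactomorphisms, along which it varies continuously without vanishing
    ([conformal_factor_gt0]).

    As [g_t] need not be a contactomorphism, [phi_t] may be any diffeomorphism,
    and every point lies on arbitrarily small closed curves that are positively
    transverse to the contact structure: a small circle in a plane
    [(x_i, y_i)], lifted in the direction [z] so that [alpha0] takes the constant
    value [r ^ 2 / 2] on its velocity with respect to the angle, where [r] is the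
    radius of the circle ([loop], [alpha0_loop_velocity]). The lift closes up
    because [pi * r ^ 2], the integral of this constant over one turn, is the
    area that the circle encloses. Let [phi_t] move every point
    [p] along its own curve, of radius [r p = eps * bump p]. The velocity for
    fixed [p] does not involve the derivative of [r], so
    [alpha0 (d/dt phi_t p) >= 0] everywhere, with a positive lower bound where
    the bump function is bounded below. Two parameters remain free. For [eps]
    small, [phi_t] differs from the identity by a map of Lipschitz constant
    [1 / 2], hence is a diffeomorphism ([twist_small], [perturbed_id_diffeo]).
    Then the number [k] of turns made by the loop multiplies the velocity, and
    outweighs the negative part of [alpha0 (X^f_t)] over the bounded set of
    those [p] that some [f_t] maps into [K1] ([preimages_bounded],
    [speed_bounded_below]). Elsewhere [alpha0 (X^f_t)] is already positive. *)

(** * Differentiability and its local nature *)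

Section Differentiability.
Variables (R : realType) (V W : normedModType R).
Implicit Types (f g : V -> W) (x : V).

(** An epsilon criterion that exhibits the differential; it serves where a
    remainder has to be estimated rather than rewritten. *)
Lemma differentiableP_eps f x (L : {linear V -> W}) : continuous L ->
  (forall e : R, 0 < e ->
     \forall h \near (0 : V), `|f (h + x) - f x - L h| <= e * `|h|) ->
  differentiable f x /\ 'd f x = L :> (V -> W).
Proof.
move=> Lc fL.
have fo : f \o shift x = cst (f x) + L +o_ 0 id.
  apply/eqaddoP => e e0; near=> h.
  rewrite /= [X in `|X|](_ : _ = f (h + x) - f x - L h); first by near: h; exact: fL.
  by rewrite !fctE /= opprD addrA.
have dL := diff_unique Lc fo; split=> //.
by apply/diff_locallyP; rewrite dL; split.
Unshelve. all: by end_near. Qed.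

Lemma differentiable_eps f x : differentiable f x -> forall e : R, 0 < e ->
  \forall h \near (0 : V), `|f (h + x) - f x - 'd f x h| <= e * `|h|.
Proof.
move=> /diff_locally /eqaddoP fo e e0; have := fo _ e0; apply: filterS => h.
by rewrite !fctE /= opprD addrA.
Qed.

Lemma near_eq_differentiable f g x : {near x, f =1 g} ->
  differentiable f x -> differentiable g x /\ 'd g x = 'd f x :> (V -> W).
Proof.
move=> fg df; apply: differentiableP_eps; first exact: diff_continuous.
move=> e e0; rewrite -(nbhs_singleton fg); near=> h.
have -> : g (h + x) = f (h + x).
  apply/esym; near: h.
  by move: fg; rewrite (near_shift 0) /= subr0.
by near: h; exact: differentiable_eps.
Unshelve. all: by end_near. Qed.

End Differentiability.

(** * Closure properties of C^k maps *)

Section CkClosure.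
Variable R : realType.
Implicit Types (V W X : normedModType R) (k : nat).

(** Destructing [Ck_on k.+1 U f] directly exposes the raw fixpoint; this
    equivalence keeps [Ck_on] folded. *)
Lemma Ck_onS V W k (U : set V) (f : V -> W) :
  Ck_on k.+1 U f <-> (forall x, U x -> differentiable f x) /\
    forall v, Ck_on k U (fun x => 'D_v f x).
Proof. by []. Qed.

Lemma Ck_on_ext V W k (U : set V) (f g : V -> W) : open U ->
  (forall x, U x -> f x = g x) -> Ck_on k U f -> Ck_on k U g.
Proof.
move=> Uo; have near_eq h h' x : (forall y, U y -> h y = h' y) -> U x ->
    {near x, (h : V -> W) =1 h'}.
  by move=> hh' Ux; apply: filterS hh' _; apply: open_nbhs_nbhs.
elim: k f g => [|k IH] f g fg /=.
  move=> fc x Ux; have := fc x Ux; rewrite /prop_for /continuous_at -(fg _ Ux).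
  by apply: cvg_trans; apply: near_eq_cvg; exact: near_eq.
case=> fd fk; split.
  by move=> x Ux; exact: (near_eq_differentiable (near_eq _ _ _ fg Ux) (fd x Ux)).1.
move=> v; apply: IH (fk v) => x Ux; apply: near_eq_derive.
exact: near_eq fg Ux.
Qed.

Lemma Ck_onW V W k (U U' : set V) (f : V -> W) : U' `<=` U ->
  Ck_on k U f -> Ck_on k U' f.
Proof.
move=> U'U; elim: k f => [|k IH] f /=; first by move=> fc x /U'U; exact: fc.
by case=> fd fk; split=> [x /U'U|v]; [exact: fd | exact: IH].
Qed.

Lemma Ck_on_pred V W k (U : set V) (f : V -> W) :
  Ck_on k.+1 U f -> Ck_on k U f.
Proof.
elim: k f => [|k IH] f; first by case=> fd _ x /fd /differentiable_continuous.
by case=> fd fk; split=> // v; exact: IH.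
Qed.

Lemma Ck_on_cst V W k (U : set V) (c : W) : Ck_on k U (fun=> c).
Proof.
elim: k c => [|k IH] c /=; first by move=> x _; exact: cvg_cst.
split=> [x _|v]; first exact: differentiable_cst.
by under eq_fun do rewrite derive_cst; exact: IH.
Qed.

Lemma Ck_on_linear_comp V W X k (U : set V) (L : {linear W -> X}) (f : V -> W) :
  continuous L -> open U -> Ck_on k U f -> Ck_on k U (L \o f).
Proof.
move=> Lc Uo; elim: k f => [|k IH] f /=.
  by move=> fc x Ux; apply: continuous_comp; [exact: fc | exact: Lc].
case=> fd fk; have Ld y : differentiable L y by exact: linear_differentiable.
split=> [x Ux|v]; first by apply: differentiable_comp => //; exact: fd.
apply: Ck_on_ext (IH _ (fk v)) => // x Ux; rewrite /= (deriveE _ (fd _ Ux)) deriveE.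
  by rewrite (diff_comp (fd _ Ux) (Ld _)) diff_lin.
by apply: differentiable_comp => //; exact: fd.
Qed.

Lemma Ck_on_linear V W k (U : set V) (L : {linear V -> W}) :
  continuous L -> Ck_on k U L.
Proof.
move=> Lc; case: k => [|k] /=; first by move=> x _; exact: Lc.
have Ld y : differentiable L y by exact: linear_differentiable.
split=> // v.
by under eq_fun do rewrite deriveE // diff_lin //; exact: Ck_on_cst.
Qed.

Lemma Ck_onD V W k (U : set V) (f g : V -> W) : open U ->
  Ck_on k U f -> Ck_on k U g -> Ck_on k U (fun x => f x + g x).
Proof.
move=> Uo; elim: k f g => [|k IH] f g /=.
  by move=> fc gc x Ux; apply: cvgD; [exact: fc | exact: gc].
move=> [fd fk] [gd gk]; split=> [x Ux|v].
  by apply: differentiableD; [exact: fd | exact: gd].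
apply: Ck_on_ext (IH _ _ (fk v) (gk v)) => // x Ux.
by rewrite /= (deriveD (f := f) (g := g)) //; apply: diff_derivable; [exact: fd | exact: gd].
Qed.

Lemma scaler_is_bilinear V : bilinear_for
  (GRing.Scale.Law.clone _ _ *:%R _) (GRing.Scale.Law.clone _ _ *:%R _)
  (@GRing.scale R V).
Proof.
split=> [u'|u] a x y /=; first by rewrite scalerDl scalerA.
by rewrite scalerDr !scalerA mulrC.
Qed.

HB.instance Definition _ V := bilinear_isBilinear.Build R R V V _ _
  (@GRing.scale R V) (@scaler_is_bilinear V).

Lemma differentiable_scale V W (r : V -> R) (w : V -> W) x :
  differentiable r x -> differentiable w x ->
  differentiable (fun y => r y *: w y) x /\
  forall v, 'D_v (fun y => r y *: w y) x = r x *: 'D_v w x + 'D_v r x *: w x.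
Proof.
move=> rd wd; pose b : {bilinear R -> W -> W} := @GRing.scale R W.
have bc : continuous (fun p : R * W => b p.1 p.2) by exact: scale_continuous.
have bd := differentiable_bilin (r x, w x) bc.
have pd := differentiable_pair rd wd.
have -> : (fun y => r y *: w y) =
  (fun p : R * W => b p.1 p.2) \o (fun y => (r y, w y)) by [].
split=> [|v]; first exact: differentiable_comp.
rewrite (deriveE v (differentiable_comp pd bd)) (diff_comp pd bd).
by rewrite (diff_bilin _ bc) /= (diff_pair rd wd) (deriveE v rd) (deriveE v wd).
Qed.

Lemma Ck_onZ V W k (U : set V) (r : V -> R) (w : V -> W) : open U ->
  Ck_on k U r -> Ck_on k U w -> Ck_on k U (fun x => r x *: w x).
Proof.
move=> Uo; elim: k r w => [|k IH] r w.
  by move=> rc wc x Ux; apply: cvgZ; [exact: rc | exact: wc].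
move=> rk wk; have [/Ck_onS[rd drk] /Ck_onS[wd dwk]] := (rk, wk).
split=> [x Ux|v]; first exact: (differentiable_scale (rd _ Ux) (wd _ Ux)).1.
apply: (Ck_on_ext (f := fun x => r x *: 'D_v w x + 'D_v r x *: w x)) => //.
  by move=> x Ux; rewrite (differentiable_scale (rd _ Ux) (wd _ Ux)).2.
by apply: Ck_onD => //; [apply: IH _ (dwk v) | apply: IH (drk v) _];
  [exact: Ck_on_pred rk | exact: Ck_on_pred wk].
Qed.

Lemma Ck_onM V k (U : set V) (f g : V -> R) : open U ->
  Ck_on k U f -> Ck_on k U g -> Ck_on k U (fun x => f x * g x).
Proof. exact: Ck_onZ. Qed.

Lemma Ck_on_sum V W k (U : set V) (I : Type) (r : seq I) (P : pred I) (f : I -> V -> W) :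
  open U -> (forall i, Ck_on k U (f i)) ->
  Ck_on k U (fun x => \sum_(i <- r | P i) f i x).
Proof.
move=> Uo fk; elim: r => [|i r IH].
  under eq_fun do rewrite big_nil.
  exact: Ck_on_cst.
under eq_fun do rewrite big_cons.
case: (P i) => //. apply: (Ck_onD (f := f i)) => //; exact: fk.
Qed.

Lemma Ck_on_prod V k (U : set V) (I : Type) (r : seq I) (f : I -> V -> R) :
  open U -> (forall i, Ck_on k U (f i)) ->
  Ck_on k U (fun x => \prod_(i <- r) f i x).
Proof.
move=> Uo fk; elim: r => [|i r IH].
  under eq_fun do rewrite big_nil.
  exact: Ck_on_cst.
by under eq_fun do rewrite big_cons; apply: (Ck_onM (f := f i)) => //; exact: fk.
Qed.

Lemma Ck_onV V k (U : set V) (f : V -> R) : open U ->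
  (forall x, U x -> f x != 0) -> Ck_on k U f -> Ck_on k U (fun x => (f x)^-1).
Proof.
move=> Uo f0; elim: k => [|k IH].
  by move=> fc x Ux; apply: cvgV; [exact: f0 | exact: fc].
move=> fk; have /Ck_onS[fd dfk] := fk; split=> [x Ux|v].
  by apply: differentiableV; [exact: fd | exact: f0].
apply: (Ck_on_ext (f := fun x => - 1 * ((f x)^-1 * (f x)^-1 * 'D_v f x))) => //.
  move=> x Ux; rewrite /= (deriveV (f := f)) ?f0 //.
    by rewrite mulN1r -invfM -expr2 scaleNr.
  exact: diff_derivable (fd _ Ux).
have fVk : Ck_on k U (fun x => (f x)^-1) by apply: IH; exact: Ck_on_pred.
apply: Ck_onM => //; first exact: Ck_on_cst.
by apply: Ck_onM => //; exact: Ck_onM.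
Qed.


(** Finite dimensionality, in the form in which the chain rule uses it. *)
Definition has_coordinates V := exists (m : nat) (e : 'I_m -> V)
  (c : 'I_m -> {linear V -> R}), (forall i, continuous (c i)) /\
  forall v, v = \sum_i c i v *: e i.

(** In the chain rule ['D_v (f \o g) x] the direction ['D_v g x] depends on [x].
    Expanding it in coordinates leaves the derivatives of [f] in fixed
    directions, to which the induction hypothesis applies. *)
Lemma Ck_on_comp V W X k (U : set X) (U' : set V) (g : X -> V) (f : V -> W) :
  has_coordinates V -> open U -> open U' -> (forall x, U x -> U' (g x)) ->
  Ck_on k U g -> Ck_on k U' f -> Ck_on k U (f \o g).
Proof.
move=> [m [e [c [cc ce]]]] Uo U'o UU'; elim: k f => [|k IH] f gk fk.
  by move=> x Ux; apply: continuous_comp; [exact: gk | apply: fk; exact: UU'].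
have [/Ck_onS[gd dgk] /Ck_onS[fd dfk]] := (gk, fk).
split=> [x Ux|v].
  by apply: differentiable_comp; [exact: gd | apply: fd; exact: UU'].
apply: (Ck_on_ext (f := fun x => \sum_i c i ('D_v g x) *: 'D_(e i) f (g x))) => //.
  move=> x Ux; have [gdx fdx] := (gd _ Ux, fd _ (UU' _ Ux)).
  rewrite (deriveE v (differentiable_comp gdx fdx)) (diff_comp gdx fdx) /=.
  rewrite [in RHS](ce ('d g x v)) linear_sum; apply: eq_bigr => i _.
  by rewrite linearZ /= !deriveE.
apply: Ck_on_sum => // i; apply: Ck_onZ => //.
  exact: (Ck_on_linear_comp (cc i) Uo (dgk v)).
exact: (IH _ (Ck_on_pred gk) (dfk (e i))).
Qed.

Lemma has_coordinates_real : has_coordinates R.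
Proof.
exists 1%N, (fun=> 1), (fun=> idfun); split; first by move=> _ x.
by move=> v; rewrite big_ord_recl big_ord0 addr0 /= [_ *: _]mulr1.
Qed.

Lemma has_coordinates_rV m : has_coordinates 'rV[R]_m.
Proof.
have lin i : linear (fun u : 'rV[R]_m => u ord0 i : R).
  by move=> a u v; rewrite !mxE.
pose c i : {linear 'rV[R]_m -> R} := HB.pack (fun u : 'rV[R]_m => u ord0 i : R)
  (GRing.isLinear.Build _ _ _ _ _ (lin i)).
exists m, (fun i => delta_mx 0 i), c; split; first by move=> i; exact: coord_continuous.
exact: row_sum_delta.
Qed.

Lemma has_coordinates_prod V W :
  has_coordinates V -> has_coordinates W -> has_coordinates (V * W)%type.
Proof.
move=> [m [e [c [cc ce]]]] [m' [e' [c' [cc' ce']]]].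
have lin1 i : linear (fun p : V * W => c i p.1).
  by move=> a u v; rewrite /= linearP.
have lin2 i : linear (fun p : V * W => c' i p.2).
  by move=> a u v; rewrite /= linearP.
pose d1 i : {linear (V * W)%type -> R} := HB.pack (fun p : V * W => c i p.1)
  (GRing.isLinear.Build _ _ _ _ _ (lin1 i)).
pose d2 i : {linear (V * W)%type -> R} := HB.pack (fun p : V * W => c' i p.2)
  (GRing.isLinear.Build _ _ _ _ _ (lin2 i)).
exists (m + m')%N,
  (fun i : 'I_(m + m') =>
     match fintype.split i with inl j => (e j, 0) | inr j => (0, e' j) end),
  (fun i : 'I_(m + m') => match fintype.split i with inl j => d1 j | inr j => d2 j end); split.
  move=> i; case: (fintype.split i) => j; move=> p.
    by apply: (@continuous_comp _ _ _ (fst : V * W -> V)); [exact: cvg_fst | exact: cc].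
  by apply: (@continuous_comp _ _ _ (snd : V * W -> W)); [exact: cvg_snd | exact: cc'].
move=> [v w]; rewrite big_split_ord /=.
under eq_bigr => i _ do rewrite (unsplitK (inl i)) /=.
under [X in _ + X]eq_bigr => i _ do rewrite (unsplitK (inr i)) /=.
apply/eqP; rewrite xpair_eqE; apply/andP; split; apply/eqP.
  rewrite /= !raddf_sum /= [X in _ + X]big1 ?addr0; last by move=> i _; exact: scaler0.
  exact: ce.
rewrite /= !raddf_sum /= [X in X + _]big1 ?add0r; last by move=> i _; exact: scaler0.
exact: ce'.
Qed.

End CkClosure.

(** * Matrices, pairs and smooth maps on subsets *)

Section SmoothMatrices.
Variable R : realType.
Implicit Types (V W X : normedModType R) (k : nat).

Lemma Ck_on_rV V k m (U : set V) (f : V -> 'rV[R]_m) : open U ->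
  (forall i, Ck_on k U (fun x => f x ord0 i : R)) -> Ck_on k U f.
Proof.
move=> Uo fk.
rewrite (_ : f = fun x => \sum_i f x ord0 i *: delta_mx 0 i); last first.
  by apply/funext => x; rewrite -row_sum_delta.
by apply: Ck_on_sum => // i; apply: Ck_onZ => //; exact: Ck_on_cst.
Qed.

Definition coord m n (i : 'I_m) (j : 'I_n) (M : 'M[R]_(m, n)) : R := M i j.

Fact coord_is_linear m n (i : 'I_m) (j : 'I_n) : linear (@coord m n i j).
Proof. by move=> a u v; rewrite /coord !mxE. Qed.

HB.instance Definition _ m n (i : 'I_m) (j : 'I_n) :=
  GRing.isLinear.Build _ _ _ _ (@coord m n i j) (@coord_is_linear m n i j).

Lemma Ck_on_coord V k m n (U : set V) (f : V -> 'M[R]_(m, n)) i j : open U ->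
  Ck_on k U f -> Ck_on k U (fun x => f x i j : R).
Proof.
by move=> Uo fk; apply: (Ck_on_linear_comp (L := @coord m n i j)) => //;
  exact: coord_continuous.
Qed.

Lemma Ck_on_det V k m (U : set V) (A : V -> 'M[R]_m) : open U ->
  (forall i j, Ck_on k U (fun x => A x i j : R)) ->
  Ck_on k U (fun x => \det (A x)).
Proof.
move=> Uo Ak; rewrite /determinant; apply: Ck_on_sum => // s.
by apply: Ck_onM => //; [exact: Ck_on_cst | exact: Ck_on_prod].
Qed.

(** By Cramer's rule, the entries of the inverse are cofactors divided by the
    determinant. *)
Lemma Ck_on_invmx V k m (U : set V) (A : V -> 'M[R]_m) : open U ->
  (forall x, U x -> A x \in unitmx) ->
  (forall i j, Ck_on k U (fun x => A x i j : R)) ->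
  forall i j, Ck_on k U (fun x => invmx (A x) i j : R).
Proof.
move=> Uo Au Ak i j.
apply: (Ck_on_ext (f := fun x => (\det (A x))^-1 * cofactor (A x) j i)) => //.
  by move=> x Ux; rewrite /invmx (Au _ Ux) !mxE.
apply: Ck_onM => //.
  apply: Ck_onV; [exact: Uo | | exact: Ck_on_det].
  by move=> x /Au; rewrite unitmxE unitfE.
apply: Ck_onM => //; first exact: Ck_on_cst.
by apply: Ck_on_det => // i' j'; under eq_fun do rewrite !mxE.
Qed.

Lemma Ck_on_pair V W X k (U : set V) (f : V -> W) (g : V -> X) : open U ->
  Ck_on k U f -> Ck_on k U g -> Ck_on k U (fun x => (f x, g x)).
Proof.
move=> Uo.
have linl : linear (fun w : W => (w, 0 : X)).
  by move=> a u v; rewrite -[RHS]/(_, _) /= scaler0 addr0.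
have linr : linear (fun z : X => (0 : W, z)).
  by move=> a u v; rewrite -[RHS]/(_, _) /= scaler0 addr0.
pose il : {linear W -> (W * X)%type} := HB.pack (fun w : W => (w, 0 : X))
  (GRing.isLinear.Build _ _ _ _ _ linl).
pose ir : {linear X -> (W * X)%type} := HB.pack (fun z : X => (0 : W, z))
  (GRing.isLinear.Build _ _ _ _ _ linr).
move=> fk gk.
apply: (Ck_on_ext (f := fun x => (il \o f) x + (ir \o g) x)) => //.
  by move=> x _; rewrite /= -[LHS]/(_, _) /= addr0 add0r.
apply: Ck_onD => //; apply: Ck_on_linear_comp => //= x.
  by apply: cvg_pair => //=; exact: cvg_cst.
by apply: cvg_pair => //=; exact: cvg_cst.
Qed.

Lemma Ck_on_fst V W k (U : set (V * W)%type) : Ck_on k U (fst : V * W -> V).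
Proof.
have lin : linear (fst : V * W -> V) by [].
pose L : {linear (V * W)%type -> V} := HB.pack (fst : V * W -> V)
  (GRing.isLinear.Build _ _ _ _ _ lin).
by apply: (Ck_on_linear k U (L := L)) => x; exact: cvg_fst.
Qed.

Lemma Ck_on_snd V W k (U : set (V * W)%type) : Ck_on k U (snd : V * W -> W).
Proof.
have lin : linear (snd : V * W -> W) by [].
pose L : {linear (V * W)%type -> W} := HB.pack (snd : V * W -> W)
  (GRing.isLinear.Build _ _ _ _ _ lin).
by apply: (Ck_on_linear k U (L := L)) => x; exact: cvg_snd.
Qed.

Lemma Ck_on_id V k (U : set V) : Ck_on k U (id : V -> V).
Proof. by apply: (Ck_on_linear k U (L := idfun)) => x. Qed.

Lemma Ck_on_continuous V W k (U : set V) (f : V -> W) x :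
  Ck_on k U f -> U x -> {for x, continuous f}.
Proof. by elim: k => [fc|k IH /Ck_on_pred]; [exact: fc | exact: IH]. Qed.

Lemma Ck_smooth_on V W (A : set V) (f : V -> W) :
  (forall k, Ck_on k setT f) -> smooth_on A f.
Proof. by move=> fk a _; exists setT, f; split=> //; exact: openT. Qed.

Lemma smooth_on_comp V W X (A : set V) (B : set X) (f : V -> W) (g : X -> V) :
  has_coordinates V -> (forall x, B x -> A (g x)) ->
  smooth_on A f -> smooth_on B g -> smooth_on B (f \o g).
Proof.
move=> cV gBA fs gs b Bb; have [U [G [Uo Ub Gk UG]]] := gs b Bb.
have Gb : G b = g b by apply: UG; rewrite inE.
have [U' [F [U'o U'b Fk UF]]] := fs _ (gBA _ Bb).
exists (U `&` G @^-1` U'), (F \o G); split.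
- rewrite openE => x [Ux U'x]; apply: filterI; first exact: open_nbhs_nbhs.
  by apply: (Ck_on_continuous (Gk 0%N) Ux); exact: open_nbhs_nbhs.
- by split=> //=; rewrite Gb.
- have Wo : open (U `&` G @^-1` U').
    rewrite openE => x [Ux U'x]; apply: filterI; first exact: open_nbhs_nbhs.
    by apply: (Ck_on_continuous (Gk 0%N) Ux); exact: open_nbhs_nbhs.
  move=> k; apply: (Ck_on_comp (U' := U')) => //; first by move=> x [].
  by apply: Ck_onW (Gk k) => x [].
move=> x; rewrite inE => -[Bx [Ux U'x]] /=.
have Gx : G x = g x by apply: UG; rewrite inE.
by move: U'x; rewrite /= Gx => U'x; apply: UF; rewrite inE; split=> //; exact: gBA.
Qed.

End SmoothMatrices.

(** * Lipschitz estimates and contractions *)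

HB.instance Definition _ (R : realType) m n := Complete.on 'M[R]_(m, n).

Section Lipschitz.
Variable R : realType.

Lemma normr_coord_le m (v : 'rV[R]_m) i : `|v ord0 i| <= `|v|.
Proof. by rewrite [leRHS]/Num.norm /= mx_normrE (le_bigmax _ _ (ord0, i)). Qed.

Lemma normr_rV_le m (v : 'rV[R]_m) (c : R) : 0 <= c ->
  (forall i, `|v ord0 i| <= c) -> `|v| <= c.
Proof.
move=> c0 vc; rewrite [leLHS]/Num.norm /= mx_normrE; apply/bigmax_leP; split=> //.
by case=> i j _; rewrite ord1; exact: vc.
Qed.

(** The mean value theorem along the segment from [x] to [y]; only the points of
    the segment matter, so that it applies on balls as well as globally. *)
Lemma real_lipschitz_segment (V : normedModType R) (f : V -> R) (x y : V) (c : R) :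
  (forall t : R, 0 <= t <= 1 -> differentiable f (t *: (y - x) + x) /\
     `|'D_(y - x) f (t *: (y - x) + x)| <= c) ->
  `|f y - f x| <= c.
Proof.
move=> fxy; set v := y - x in fxy *.
pose l (t : R) := t *: v + x.
have dl t : is_diff t l ( *:%R^~ v).
  by apply: is_diff_eq; rewrite addr0.
have dfl (t : R) : 0 <= t <= 1 -> is_derive t 1 (f \o l) ('D_v f (l t)).
  move=> t01; have [fd _] := fxy t t01.
  have [ld lE] := dl t.
  have fld := differentiable_comp ld fd.
  apply: DeriveDef; first exact: diff_derivable.
  by rewrite deriveE // (diff_comp ld fd) /= lE scale1r deriveE.
have [t||t t01 fE] :=
    @MVT_segment R (f \o l) (fun t => 'D_v f (l t)) 0 1 ler01.
- by rewrite in_itv /= => /andP[t0 t1]; apply: dfl; rewrite !ltW.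
- apply: derivable_within_continuous => t; rewrite in_itv /= => t01.
  by have := dfl t t01.
move: fE; rewrite /= /l scale1r scale0r add0r /v subrK subr0 mulr1 => ->.
by have [] := fxy t; [rewrite in_itv in t01 | move=> _; exact].
Qed.

Lemma rV_lipschitz_segment (V : normedModType R) m (f : V -> 'rV[R]_m) (x y : V)
    (c : R) :
  (forall t : R, 0 <= t <= 1 -> differentiable f (t *: (y - x) + x) /\
     `|'D_(y - x) f (t *: (y - x) + x)| <= c) ->
  `|f y - f x| <= c.
Proof.
move=> fxy; apply: normr_rV_le => [|i].
  by have [|_] := fxy 0; [rewrite lexx ler01 | exact: le_trans].
rewrite !mxE; pose f_ := @coord R 1 m ord0 i \o f.
rewrite -[_ - _]/(f_ y - f_ x); apply: real_lipschitz_segment => t t01.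
have [fd fc] := fxy t t01.
have cd z : differentiable (@coord R 1 m ord0 i) z.
  by apply: linear_differentiable; exact: coord_continuous.
have f_d := differentiable_comp fd (cd _); split=> //.
apply: le_trans fc; rewrite deriveE // (diff_comp fd (cd _)) /=.
rewrite diff_lin; last exact: coord_continuous.
by rewrite deriveE //; exact: normr_coord_le.
Qed.

Lemma normr_derive_le (W : normedModType R) m (f : 'rV[R]_m -> W) x v :
  differentiable f x ->
  `|'D_v f x| <= (\sum_i `|'D_(delta_mx 0 i) f x|) * `|v|.
Proof.
move=> fd; rewrite deriveE // {1}(row_sum_delta v) linear_sum mulr_suml.
apply: le_trans (ler_norm_sum _ _ _) _; apply: ler_sum => i _.
by rewrite linearZ /= normrZ mulrC deriveE // ler_wpM2l // normr_coord_le.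
Qed.

Lemma closed_normr_le (V : normedModType R) (p0 : V) (r : R) :
  closed [set p : V | `|p - p0| <= r].
Proof.
apply: (@closed_comp _ _ (fun p : V => `|p - p0|) [set x | x <= r]).
  by move=> p _; apply: cvg_norm; apply: cvgB; [exact: cvg_id | exact: cvg_cst].
exact: closed_le.
Qed.

Lemma normr_le_compact m (r : R) : compact [set p : 'rV[R]_m | `|p| <= r].
Proof.
apply: bounded_closed_compact.
  exists r; split; first exact: num_real.
  by move=> x rx p /= pr; apply: le_trans pr (ltW rx).
rewrite (_ : mkset _ = [set p : 'rV[R]_m | `|p - 0| <= r]).
  exact: closed_normr_le.
by apply/seteqP; split=> p /=; rewrite subr0.
Qed.

(** The bound on [T p0] keeps the closed ball stable under [T], where the Banach
    fixed point theorem applies. *)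
Lemma contraction_ball (V : completeNormedModType R) (T : V -> V) (p0 : V)
    (r : R) : 0 <= r ->
  (forall x y, `|x - p0| <= r -> `|y - p0| <= r ->
     `|T x - T y| <= 2^-1 * `|x - y|) ->
  `|T p0 - p0| <= r / 2 -> exists2 p, `|p - p0| <= r & T p = p.
Proof.
move=> r0 Tc Tp0; pose B := [set p : V | `|p - p0| <= r].
have TB : {homo T : p / B p >-> B p}.
  move=> p Bp; rewrite /B /= -(subrKA (T p0)) (le_trans (ler_normD _ _)) //.
  rewrite [leRHS](splitr r) lerD // (le_trans (Tc _ _ Bp _)) ?subrr ?normr0 //.
  by rewrite mulrC ler_pM2r ?invr_gt0.
pose f : {fun B >-> B} := HB.pack T (isFun.Build _ _ B B T TB).
have [|||p Bp pT] := banach_fixed_point (f := f); last by exists p.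
- exists (2^-1)%:nng; split=> /=; first by rewrite invf_lt1 ?ltr1n.
  by move=> [x y] /= [Bx By]; exact: Tc.
- exact: closed_normr_le.
- by exists p0; rewrite /B /= subrr normr0.
Qed.

Lemma bounded_of_compact_support m (f : 'rV[R]_m -> R) (r : R) :
  continuous f -> (forall x, r < `|x| -> f x = 0) ->
  exists2 M : R, 0 <= M & forall x, `|f x| <= M.
Proof.
move=> fc f0.
have /compact_bounded [M [_ fM]] : compact (f @` [set p | `|p| <= r]).
  apply: continuous_compact; last exact: normr_le_compact.
  exact: continuous_subspaceT.
exists (`|M| + 1) => [|x]; first by rewrite addr_ge0.
have [xr|/f0 ->] := leP `|x| r; last by rewrite normr0 addr_ge0.
apply: fM; last by exists x.
by rewrite (le_lt_trans (ler_norm M)) // ltrDl.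
Qed.

(** The derivatives also vanish outside the ball, so they are bounded, and the
    mean value theorem applies. *)
Lemma lipschitz_of_compact_support m (f : 'rV[R]_m -> R) (r : R) :
  Ck_on 1 setT f -> (forall x, r < `|x| -> f x = 0) ->
  exists2 M : R, 0 <= M & (forall x, `|f x| <= M) /\
    (forall x y, `|f x - f y| <= M * `|x - y|).
Proof.
move=> /Ck_onS [fd dfc] f0.
have [|M M0 fM] := @bounded_of_compact_support m f r _ f0.
  by move=> x; apply: differentiable_continuous; exact: fd.
have Df0 i x : r < `|x| -> 'D_(delta_mx 0 i) f x = 0.
  move=> rx; rewrite -(derive_cst (0 : R) x (delta_mx 0 i)).
  apply: near_eq_derive.
  have : nbhs x (~` [set p : 'rV[R]_m | `|p - 0| <= r]).
    apply: open_nbhs_nbhs; split; first exact/closed_openC/closed_normr_le.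
    by rewrite /= subr0; apply/negP; rewrite -ltNge.
  by apply: filterS => y /= /negP; rewrite subr0 -ltNge => /f0.
have /(_ _)/cid2 bD i := @bounded_of_compact_support m _ r
  (fun x => dfc (delta_mx 0 i) x I) (Df0 i).
pose M' := \sum_i s2val (bD i).
have M'0 : 0 <= M' by apply: sumr_ge0 => i _; case: (bD i).
exists (M + M'); first exact: addr_ge0.
split=> x; first by rewrite (le_trans (fM x)) // lerDl.
move=> y; apply: real_lipschitz_segment => t _; split; first exact: fd.
apply: le_trans (normr_derive_le _ (fd _ I)) _.
rewrite ler_wpM2r // ler_wpDl // ler_sum // => i _.
by case: (bD i) => M'' /= _; apply.
Qed.

End Lipschitz.

(** * Small perturbations of the identity *)

Section PerturbationOfIdentity.
Variable R : realType.

Lemma linear_rV_continuous m (W : normedModType R) (L : {linear 'rV[R]_m -> W}) :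
  continuous L.
Proof.
have Lk : Ck_on 0 setT (fun v : 'rV[R]_m => \sum_i v ord0 i *: L (delta_mx 0 i)).
  apply: Ck_on_sum; first exact: openT.
  move=> i; apply: Ck_onZ; [exact: openT | | exact: Ck_on_cst].
  by apply: Ck_on_coord; [exact: openT | exact: Ck_on_id].
rewrite (_ : (L : 'rV[R]_m -> W) = fun v => \sum_i v ord0 i *: L (delta_mx 0 i)).
  by move=> v; exact: Lk.
apply/funext => v; rewrite {1}(row_sum_delta v) linear_sum.
by apply: eq_bigr => i _; rewrite linearZ.
Qed.

(** [p + eta p = q] says that [p] is a fixed point of the contraction
    [p |-> q - eta p]. Moreover [p |-> p + eta p] shrinks distances by a factor of
    at most [2], which makes the inverse [psi] Lipschitz and the Jacobian [J]
    invertible. Then [psi] is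
    differentiable with [D psi = (J o psi)^-1], a formula that improves the
    regularity of [psi] by one order at each step of an induction. *)
Lemma perturbed_id_diffeo m (eta : 'rV[R]_m -> 'rV[R]_m) :
  (forall k, Ck_on k setT eta) ->
  (forall x y, `|eta x - eta y| <= 2^-1 * `|x - y|) ->
  exists psi : 'rV[R]_m -> 'rV[R]_m,
    [/\ cancel (fun p => p + eta p) psi, cancel psi (fun p => p + eta p) &
        forall k, Ck_on k setT psi].
Proof.
move=> etak etal; pose phi p := p + eta p.
have phik k : Ck_on k setT phi.
  by apply: Ck_onD => //; [exact: openT | exact: Ck_on_id].
have phid p : differentiable phi p by have /Ck_onS[fd _] := phik 1%N; exact: fd.
have expand x y : `|x - y| <= 2 * `|phi x - phi y|.
  have := ler_normD (phi x - phi y) (eta y - eta x).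
  rewrite (_ : phi x - phi y + _ = x - y); last first.
    by rewrite /phi; apply/rowP => i; rewrite !mxE; ring.
  by have := etal y x; rewrite (distrC y x); lra.
have phi_inj : injective phi.
  move=> x y xy; have := expand x y.
  by rewrite xy subrr normr0 mulr0 normr_le0 subr_eq0 => /eqP.
have /choice [psi psiK] : forall q, exists p, phi p = q.
  move=> q; pose T p := q - eta p.
  have [|||p _ pT] := @contraction_ball R 'rV[R]_m T 0 (2 * `|T 0|).
  - exact: mulr_ge0.
  - move=> x y _ _; rewrite /T (_ : _ - _ = eta y - eta x).
      by rewrite (distrC x); exact: etal.
    by apply/rowP => i; rewrite !mxE; ring.
  - by rewrite subr0 mulrAC divff ?mul1r ?pnatr_eq0.
  by exists p; rewrite /phi -[X in X + _]pT subrK.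
have phiK : cancel phi psi by move=> p; apply: phi_inj; rewrite psiK.
exists psi; split=> //.
pose J p := jacobian phi p.
have JE p v : 'd phi p v = v *m J p by rewrite -deriveE // deriveEjacobian.
have Ju p : J p \in unitmx.
  (* a kernel vector v, rescaled to a small h, would give |h| <= 2 * (1/4) * |h| *)
  rewrite -row_free_unit; apply/row_freeP; apply: contrapT => nfree.
  have [v vJ v0] : exists2 v : 'rV[R]_m, v *m J p = 0 & v != 0.
    have : ~~ row_free (J p) by apply/negP => /row_freeP.
    rewrite -kermx_eq0 => /rowV0Pn [v /sub_kermxP vJ v0].
    by exists v.
  have e0 : 0 < 4^-1 :> R by rewrite invr_gt0.
  have /nbhs_ballP [d /= d0 dphi] := differentiable_eps (phid p) e0.
  have nv : 0 < `|v| by rewrite normr_gt0.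
  pose h := (d / 2 / `|v|) *: v.
  have nh : `|h| = d / 2.
    by rewrite normrZ ger0_norm ?divr_ge0 ?(ltW d0) // divfK // gt_eqF.
  have /dphi : ball 0 d h.
    by rewrite -ball_normE /= sub0r normrN nh ltr_pdivrMr // ltr_pMr // ltr1n.
  rewrite JE -scalemxAl vJ scaler0 subr0.
  by have := expand (h + p) p; rewrite addrK nh; lra.
pose L p : {linear 'rV[R]_m -> 'rV[R]_m} := mulmxr (invmx (J p)).
have psid q : differentiable psi q /\ 'd psi q = L (psi q) :> ('rV[R]_m -> 'rV[R]_m).
  apply: differentiableP_eps; first exact: linear_rV_continuous.
  move=> e e0; set p := psi q.
  have [C C0 LC] := linear_lipschitz (linear_rV_continuous (L := L p)).
  have e'0 : 0 < e / (2 * C) by rewrite divr_gt0 ?mulr_gt0.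
  have /nbhs_ballP [d /= d0 dphi] := differentiable_eps (phid p) e'0.
  apply/nbhs_ballP; exists (d / 2) => /=; first by rewrite divr_gt0.
  move=> h; rewrite -ball_normE /= sub0r normrN => hd.
  pose k := psi (h + q) - p.
  have kh : `|k| <= 2 * `|h| by rewrite /k (le_trans (expand _ _)) // !psiK addrK.
  have /dphi : ball 0 d k.
    by rewrite -ball_normE /= sub0r normrN (le_lt_trans kh) // mulrC -ltr_pdivlMr.
  rewrite subrK !psiK addrK => hk.
  rewrite -/k (_ : k - L p h = - L p (h - 'd phi p k)); last first.
    by rewrite linearB /= JE mulmxK // opprB.
  rewrite normrN (le_trans (LC _)) //.
  apply: (@le_trans _ _ (C * (e / (2 * C) * `|k|))); first by rewrite ler_pM2l.
  rewrite (_ : C * _ = e / 2 * `|k|); last by field; rewrite gt_eqF.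
  have : e / 2 * `|k| <= e / 2 * (2 * `|h|) by rewrite ler_pM2l ?divr_gt0.
  by rewrite mulrA divfK ?pnatr_eq0.
have phiJ k i j : Ck_on k setT (fun p => J p i j : R).
  apply: (Ck_on_ext (f := fun p => 'D_(delta_mx 0 i) phi p ord0 j)).
  - exact: openT.
  - by move=> p _; rewrite deriveEjacobian // -rowE mxE.
  by apply: Ck_on_coord; [exact: openT | have /Ck_onS[_] := phik k.+1].
elim=> [|k IH]; first by move=> q _; apply: differentiable_continuous; exact: (psid q).1.
split=> [q _|v]; first exact: (psid q).1.
apply: (Ck_on_ext (f := fun q => v *m invmx (J (psi q)))); first exact: openT.
  by move=> q _; rewrite deriveE ?(psid q).2 //; exact: (psid q).1.
apply: Ck_on_rV => [|i]; first exact: openT.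
under eq_fun do rewrite mxE.
apply: Ck_on_sum => [|j]; first exact: openT.
apply: Ck_onM; [exact: openT | exact: Ck_on_cst |].
apply: Ck_on_invmx => [||i' j']; [exact: openT | by move=> *; exact: Ju |].
apply: (Ck_on_comp (U' := setT) (g := psi) (f := fun p => J p i' j')) => //;
  [exact: has_coordinates_rV | exact: openT | exact: openT].
Qed.

End PerturbationOfIdentity.

(** * A smooth bump function *)

Section Bump.
Variable R : realType.

(** The flat function [exp (- 1 / x)] is [flat 0]; its derivatives are
    combinations of the functions [flat n]. *)
Definition flat (n : nat) (x : R) : R :=
  if 0 < x then x^-1 ^+ n * expR (- x^-1) else 0.

(** This follows from [u ^ (n + 2) / (n + 2)! <= exp u] at [u = 1 / x]; the
    quadratic decay is what makes [flat n] differentiable at [0]. *)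
Lemma flat_le n (x : R) : `|flat n x| <= (n.+2)`!%:R * `|x| ^+ 2.
Proof.
rewrite /flat; case: ifPn => [x0|_]; last first.
  by rewrite normr0 mulr_ge0 // exprn_ge0.
have u0 : 0 < x^-1 by rewrite invr_gt0.
rewrite (ger0_norm (ltW x0)) ger0_norm; last first.
  by rewrite mulr_ge0 ?expR_ge0 // exprn_ge0 // ltW.
rewrite expRN ler_pdivrMr ?expR_gt0 //.
have := expR_ge1Dxn n.+1 (ltW u0).
set E := expR _; set u := x^-1 => uE.
have f0 : 0 < (n.+2)`!%:R :> R by rewrite ltr0n fact_gt0.
have {}uE : u ^+ n.+2 <= (n.+2)`!%:R * E.
  rewrite mulrC -ler_pdivrMr //; apply: le_trans uE.
  by rewrite lerDr.
have -> : u ^+ n = x ^+ 2 * u ^+ n.+2.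
  by rewrite -(addn2 n) exprD mulrCA -exprMn divff ?gt_eqF // expr1n mulr1.
by rewrite [leRHS]mulrAC [leRHS]mulrC ler_pM2l ?exprn_gt0.
Qed.

Lemma flat_differentiable n (x : R) : differentiable (flat n) x /\
  forall v, 'D_v (flat n) x = v * (flat n.+2 x - n%:R * flat n.+1 x).
Proof.
have [x0|x0|x0] := ltgtP x 0.
- have near0 : {near x, (fun=> 0) =1 flat n}.
    near=> y; rewrite /flat ifF //; apply/negbTE; rewrite -leNgt ltW //.
    by near: y; exact: lt_nbhsl.
  have [fd fE] := near_eq_differentiable near0 (differentiable_cst (0 : R) x).
  split=> // v; rewrite deriveE // fE diff_cst /flat ltNge (ltW x0) /=.
  by rewrite mulr0 subrr mulr0.
- pose g y : R := y^-1 ^+ n * expR (- y^-1).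
  have nearg : {near x, g =1 flat n}.
    near=> y; rewrite /flat ifT //.
    by near: y; exact: lt_nbhsr.
  have dV : is_derive x 1 (fun y : R => y^-1) (- x ^- 2).
    have x0' : id x != 0 by rewrite gt_eqF.
    by have := is_deriveV x0' (is_derive_id x 1); rewrite [_ *: _]mulr1.
  have dE : is_derive x 1 (expR \o (- (fun y : R => y^-1))) (expR (- x^-1) * (x ^- 2)).
    by have := is_derive1_comp (is_derive_expR _) (is_deriveN dV); rewrite opprK.
  have dg : is_derive x 1 g (flat n.+2 x - n%:R * flat n.+1 x).
    have := is_deriveM (is_deriveX n dV) dE.
    rewrite (_ : _ * _ = g); last by apply/funext => y; rewrite -[LHS]/(_ * _) exprfctE.
    move=> dg; apply: (is_derive_eq dg); rewrite /flat x0 !exprfctE /=.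
    rewrite -[(- _) x]/(- x^-1) /GRing.scale /= -!exprVn.
    by case: (n) => [|k] /=; rewrite ?exprS; ring.
  have [gd gE] := dg; move/derivable1_diffP in gd.
  have [fd fE] := near_eq_differentiable nearg gd.
  split=> // v; rewrite deriveE // fE -gE deriveE //.
  by rewrite -[in LHS](mulr1 v) -[v * 1]/(v *: 1) linearZ.
- rewrite {x}x0; pose L : {linear R -> R} := \0.
  have [||fd fE] := @differentiableP_eps R R R (flat n) 0 L.
  + by move=> y; exact: cvg_cst.
  + move=> e e0; apply/nbhs_ballP.
    have f0 : 0 < (n.+2)`!%:R :> R by rewrite ltr0n fact_gt0.
    exists (e / (n.+2)`!%:R) => /=; first exact: divr_gt0.
    move=> h; rewrite -ball_normE /= sub0r normrN ltr_pdivlMr // mulrC => he.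
    rewrite addr0 {2}/flat ltxx !subr0 (le_trans (flat_le _ _)) //.
    by rewrite expr2 mulrA ler_wpM2r // ltW.
  split=> // v; rewrite deriveE // fE /= /flat ltxx; by rewrite mulr0 subr0 mulr0.
Unshelve. all: by end_near. Qed.

Lemma Ck_on_flat k n : Ck_on k setT (flat n).
Proof.
elim: k n => [|k IH] n.
  by move=> x _; apply: differentiable_continuous; exact: (flat_differentiable n x).1.
split=> [x _|v]; first exact: (flat_differentiable n x).1.
apply: (Ck_on_ext (f := fun x => v * (flat n.+2 x + - n%:R * flat n.+1 x))).
- exact: openT.
- by move=> x _; rewrite (flat_differentiable n x).2 mulNr.
have T := openT; apply: Ck_onM => //; first exact: Ck_on_cst.
apply: Ck_onD => //; apply: Ck_onM => //; exact: Ck_on_cst.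
Qed.

Lemma flat_homo (x y : R) : x <= y -> flat 0 x <= flat 0 y.
Proof.
rewrite /flat !expr0 !mul1r => xy.
case: ifPn => [x0|_]; last by case: ifP => // _; exact: expR_ge0.
have y0 : 0 < y by exact: lt_le_trans xy.
by rewrite y0 ler_expR lerN2 lef_pV2.
Qed.

Definition bump (m : nat) (s : R) (p : 'rV[R]_m) : R :=
  flat 0 (s - \sum_i p ord0 i ^+ 2).

Lemma Ck_on_bump m s k : Ck_on k setT (@bump m s).
Proof.
have T := @openT; apply: (Ck_on_comp (U' := setT) (f := flat 0)
  (g := fun p : 'rV[R]_m => s - \sum_i p ord0 i ^+ 2)) => //.
- exact: has_coordinates_real.
- apply: (Ck_on_ext (f := fun p : 'rV[R]_m =>
    s + - 1 * (\sum_i p ord0 i * p ord0 i))) => //.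
    by move=> p _; rewrite mulN1r; under eq_bigr do rewrite -expr2.
  apply: Ck_onD => //; first exact: Ck_on_cst.
  apply: Ck_onM => //; first exact: Ck_on_cst.
  apply: Ck_on_sum => // i; have pk : Ck_on k setT (fun p : 'rV[R]_m => p ord0 i : R).
    by apply: Ck_on_coord => //; exact: Ck_on_id.
  exact: Ck_onM.
- exact: Ck_on_flat.
Qed.

Lemma bump_support m (s : R) (p : 'rV[R]_m) : 1 <= s -> s < `|p| -> bump s p = 0.
Proof.
move=> s1 sp; rewrite /bump /flat ifF //; apply/negbTE; rewrite -leNgt subr_le0.
have [i ip] : exists i, s < `|p ord0 i|.
  apply: contrapT => /forallNP np; move: sp; apply/negP; rewrite -leNgt.
  apply: normr_rV_le => [|i]; first exact: le_trans s1.
  by have /negP := np i; rewrite -leNgt.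
rewrite (bigD1 i) //=; apply: (@le_trans _ _ (p ord0 i ^+ 2)); last first.
  by rewrite lerDl sumr_ge0 // => j _; exact: sqr_ge0.
by rewrite -(real_normK (num_real _)); nra.
Qed.

(** [m * a ^ 2] bounds the sum of squares on the ball of radius [a] of the
    maximum norm. *)
Lemma bump_ge m (s a : R) (p : 'rV[R]_m) : 0 <= a -> m%:R * a ^+ 2 + 1 <= s ->
  `|p| <= a -> expR (- 1) <= bump s p.
Proof.
move=> a0 sa pa; have -> : expR (-1) = flat 0 1 :> R.
  by rewrite /flat ltr01 mul1r invr1.
apply: flat_homo; rewrite lerBrDr addrC -lerBrDr; apply: le_trans (_ : m%:R * a ^+ 2 <= _).
  rewrite mulr_natl -[m in leRHS]card_ord -sumr_const ler_sum // => i _.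
  rewrite -real_normK ?num_real // ler_sqr ?nnegrE //.
  exact: le_trans (normr_coord_le _ _) pa.
by rewrite lerBrDr.
Qed.

End Bump.

(** * Small positively transverse loops *)

Section Loop.
Variables (R : realType) (n : nat) (i : 'I_n).

Definition xyz (a b c : R) : Rstd R n :=
  a *: delta_mx 0 (ix i) + b *: delta_mx 0 (iy i) + c *: delta_mx 0 (iz n).

Lemma eq_iy (j k : 'I_n) : (iy j == iy k) = (j == k).
Proof. by rewrite -!val_eqE /= eqn_add2l. Qed.

Lemma ix_neq_iy (j k : 'I_n) : (ix j == iy k) = false.
Proof. by rewrite -val_eqE /= ltn_eqF // ltn_addr. Qed.

Lemma ix_neq_iz (j : 'I_n) : (ix j == iz n) = false.
Proof. by rewrite -val_eqE /= ltn_eqF // ltn_addr. Qed.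

Lemma iy_neq_iz (j : 'I_n) : (iy j == iz n) = false.
Proof. by rewrite -val_eqE /= ltn_eqF // ltn_add2l. Qed.

Lemma xyz_ix a b c : xyz a b c ord0 (ix i) = a.
Proof.
by rewrite !mxE !eqxx /= ix_neq_iy ix_neq_iz !mulr0 !addr0 mulr1.
Qed.

Lemma xyz_iy a b c j : xyz a b c ord0 (iy j) = b *+ (j == i).
Proof.
rewrite !mxE !eqxx /= [iy j == ix i]eq_sym ix_neq_iy iy_neq_iz eq_iy.
by rewrite !mulr0 addr0 add0r mulr_natr.
Qed.

Lemma xyz_iz a b c : xyz a b c ord0 (iz n) = c.
Proof.
rewrite !mxE !eqxx /= [_ == ix i]eq_sym ix_neq_iz [_ == iy i]eq_sym iy_neq_iz.
by rewrite !mulr0 !add0r mulr1.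
Qed.

Lemma alpha0_xyz (p : Rstd R n) a b c :
  alpha0 p (xyz a b c) = c + p ord0 (ix i) * b.
Proof.
rewrite /alpha0 xyz_iz (bigD1 i) //= big1 => [|j ji]; rewrite xyz_iy.
  by rewrite eqxx mulr1n addr0.
by rewrite (negbTE ji) mulr0n mulr0.
Qed.

Lemma normr_xyz_le a b c : `|xyz a b c| <= `|a| + `|b| + `|c|.
Proof.
have dle (x : R) j : `|x *: delta_mx 0 j : Rstd R n| <= `|x|.
  apply: normr_rV_le => // k; rewrite !mxE normrM ler_piMr //.
  by rewrite normr_nat; case: (_ && _); rewrite ?ler01.
by rewrite (le_trans (ler_normD _ _)) // lerD // (le_trans (ler_normD _ _)) // lerD.
Qed.

Lemma xyzB a b c a' b' c' :
  xyz a b c - xyz a' b' c' = xyz (a - a') (b - b') (c - c').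
Proof. by apply/rowP => j; rewrite !mxE; ring. Qed.

(** The displacement at angle [th] of a point of coordinate [x_i = x] along a
    circle of radius [r] in the plane [(x_i, y_i)]. The component along [z] is
    the primitive vanishing at [th = 0] that makes [alpha0] constant on the
    velocity. *)
Definition loop (x r th : R) : Rstd R n :=
  xyz (r * sin th) (r * (1 - cos th))
      (r * (r * (sin th * cos th) / 2 - x * (1 - cos th))).

Definition loop_velocity (x r th : R) : Rstd R n :=
  xyz (r * cos th) (r * sin th)
      (r * (r * (cos th ^+ 2 - sin th ^+ 2) / 2 - x * sin th)).

Lemma alpha0_loop_velocity (p : Rstd R n) r th :
  alpha0 (p + loop (p ord0 (ix i)) r th) (loop_velocity (p ord0 (ix i)) r th)
    = r ^+ 2 / 2.
Proof.
rewrite alpha0_xyz mxE xyz_ix.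
rewrite (_ : cos th ^+ 2 = 1 - sin th ^+ 2); last by rewrite cos2sin2.
by field.
Qed.

Lemma loop_period x r k : loop x r (pi *+ 2 *+ k) = 0.
Proof.
rewrite /loop -[pi *+ 2 *+ k]add0r (periodicn (@sinD2pi R)).
rewrite (periodicn (@cosD2pi R)) sin0 cos0 subrr !(mul0r, mulr0, subr0) /xyz.
by rewrite !scale0r !addr0.
Qed.

Lemma is_derive_loop (x r c t : R) : is_derive t (1 : R) (fun s : R => loop x r (c * s))
  (c *: loop_velocity x r (c * t)).
Proof.
have dth : is_derive t 1 (fun s : R => c * s) c.
  have -> : (fun s : R => c * s) = c *: (id : R -> R) by [].
  by apply: is_derive_eq; rewrite /GRing.scale /= mulr1.
have ds : is_derive t 1 (fun s : R => sin (c * s)) (cos (c * t) * c).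
  exact: is_derive1_comp.
have dc : is_derive t 1 (fun s : R => cos (c * s)) (- sin (c * t) * c).
  exact: is_derive1_comp.
pose S s := sin (c * s); pose C s := cos (c * s).
have dS : is_derive t 1 (S : R -> R) (cos (c * t) * c) by [].
have dC : is_derive t 1 (C : R -> R) (- sin (c * t) * c) by [].
have dx : is_derive t 1 (r *: S) (r * (cos (c * t) * c)).
  exact: is_deriveZ.
have dy : is_derive t 1 (r *: (cst 1 - C)) (r * (c * sin (c * t))).
  by apply: is_derive_eq; rewrite sub0r /GRing.scale /=; ring.
have dz : is_derive t 1 (r *: ((r / 2) *: (S * C) - x *: (cst 1 - C)))
   (r * c * (r * (cos (c * t) ^+ 2 - sin (c * t) ^+ 2) / 2 - x * sin (c * t))).
  by apply: is_derive_eq; rewrite sub0r /GRing.scale /= /S /C; field.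
have dscale (f : R -> R) df (e : Rstd R n) : is_derive t 1 f df ->
    is_derive t 1 (fun s => f s *: e) (df *: e).
  move=> fd; have [fdd fE] := fd; move/derivable1_diffP in fdd.
  have := @differentiableZl R R (Rstd R n) f e t fdd => fed.
  by apply: DeriveDef; [exact: diff_derivable | rewrite deriveE // diffZl // -deriveE // fE].
have := is_deriveD (is_deriveD (dscale _ _ (delta_mx 0 (ix i)) dx)
  (dscale _ _ (delta_mx 0 (iy i)) dy)) (dscale _ _ (delta_mx 0 (iz n)) dz).
rewrite (_ : _ + _ + _ = fun s : R => loop x r (c * s)); last first.
  apply/funext => s; rewrite /loop /xyz !fctE /= /S /C; congr (_ + _ + _ *: _).
  by rewrite /GRing.scale /=; ring.
move=> d; apply: (is_derive_eq d).
by rewrite /loop_velocity /xyz !scalerDr !scalerA; congr (_ *: _ + _ *: _ + _ *: _); ring.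
Qed.

Lemma Ck_on_sin_cos k : Ck_on k setT (@sin R) /\ Ck_on k setT (@cos R).
Proof.
have T := @openT R.
have sind (x : R) : differentiable (@sin R) x by apply/derivable1_diffP.
have cosd (x : R) : differentiable (@cos R) x by apply/derivable1_diffP.
have Dsin v x : 'D_v (@sin R) x = v * cos x.
  rewrite deriveE // -[v in LHS](mulr1 v) -[v * 1]/(v *: 1) linearZ.
  by rewrite -deriveE // derive_val.
have Dcos v x : 'D_v (@cos R) x = - v * sin x.
  rewrite deriveE // -[v in LHS](mulr1 v) -[v * 1]/(v *: 1) linearZ.
  by rewrite -deriveE // derive_val /= [_ *: _]mulrN mulNr.
elim: k => [|k [IHs IHc]].
  by split=> x _; apply: differentiable_continuous.
split; split=> // v.
  by under eq_fun do rewrite Dsin; apply: Ck_onM => //; exact: Ck_on_cst.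
by under eq_fun do rewrite Dcos; apply: Ck_onM => //; exact: Ck_on_cst.
Qed.

(** Every point moves along its own loop; the radius is constant in [th], so the
    velocity of the motion is the velocity of that loop. *)
Definition twist (eps s : R) (th : R) (p : Rstd R n) : Rstd R n :=
  loop (p ord0 (ix i)) (eps * bump s p) th.

Lemma Ck_on_twist eps s c k :
  Ck_on k setT (fun tp : R * Rstd R n => twist eps s (c * tp.1) tp.2).
Proof.
have T := @openT (R * Rstd R n)%type; have T' := @openT R; have T2 := @openT (Rstd R n).
set A := setT.
have cstk (a : R) : Ck_on k A (fun=> a) by exact: Ck_on_cst.
have thk : Ck_on k A (fun tp : R * Rstd R n => c * tp.1).
  by apply: Ck_onM => //; exact: Ck_on_fst.
have sk : Ck_on k A (fun tp : R * Rstd R n => sin (c * tp.1)).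
  exact: (Ck_on_comp (has_coordinates_real R) T T' _ thk (Ck_on_sin_cos k).1).
have ck : Ck_on k A (fun tp : R * Rstd R n => cos (c * tp.1)).
  exact: (Ck_on_comp (has_coordinates_real R) T T' _ thk (Ck_on_sin_cos k).2).
have pk : Ck_on k A (snd : R * Rstd R n -> _) by exact: Ck_on_snd.
have bk : Ck_on k A (fun tp : R * Rstd R n => eps * bump s tp.2).
  apply: Ck_onM => //.
  apply: (Ck_on_comp (U' := setT) (g := snd) (f := bump s)) => //.
    exact: has_coordinates_rV.
  exact: Ck_on_bump.
have xk : Ck_on k A (fun tp : R * Rstd R n => tp.2 ord0 (ix i) : R) by exact: Ck_on_coord.
have omk : Ck_on k A (fun tp : R * Rstd R n => 1 - cos (c * tp.1)).
  under eq_fun do rewrite -mulN1r; apply: Ck_onD => //; exact: Ck_onM.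
have zk : Ck_on k A (fun tp : R * Rstd R n => eps * bump s tp.2 *
    (eps * bump s tp.2 * (sin (c * tp.1) * cos (c * tp.1)) / 2
     - tp.2 ord0 (ix i) * (1 - cos (c * tp.1)))).
  apply: Ck_onM => //; apply: Ck_onD => //.
    have sck := Ck_onM T sk ck.
    exact: (Ck_onM T (Ck_onM T bk sck) (cstk _)).
  under eq_fun do rewrite -mulN1r.
  exact: (Ck_onM T (cstk _) (Ck_onM T xk omk)).
rewrite /twist /loop /xyz.
have ek (e : Rstd R n) : Ck_on k A (fun=> e) by exact: Ck_on_cst.
exact: (Ck_onD T (Ck_onD T (Ck_onZ T (Ck_onM T bk sk) (ek _))
  (Ck_onZ T (Ck_onM T bk omk) (ek _))) (Ck_onZ T zk (ek _))).
Qed.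

(** Each component of [twist] is a bounded function of [th] times [eps] times one
    of the compactly supported functions [b], [x_i * b], [b * b], where [b] is
    the bump function. These three are Lipschitz, so a small [eps] suffices. *)
Lemma twist_small s : 1 <= s -> exists2 eps : R, 0 < eps & forall th,
  (forall p, `|twist eps s th p| <= 1) /\
  (forall p q, `|twist eps s th p - twist eps s th q| <= 2^-1 * `|p - q|).
Proof.
move=> s1; pose b := @bump R (n + n).+1 s; pose X (p : Rstd R n) : R := p ord0 (ix i).
have T := @openT (Rstd R n).
have bk : Ck_on 1 setT b by exact: Ck_on_bump.
have Xk : Ck_on 1 setT X by apply: Ck_on_coord => //; exact: Ck_on_id.
have b0 (p : Rstd R n) : s < `|p| -> b p = 0 by exact: bump_support.
have [M1 M10 [b1 bl]] := lipschitz_of_compact_support bk b0.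
have [|M2 M20 [Xb1 Xbl]] :=
  lipschitz_of_compact_support (Ck_onM T Xk bk) (r := s).
  by move=> p /b0 ->; rewrite mulr0.
have [|M3 M30 [bb1 bbl]] :=
  lipschitz_of_compact_support (Ck_onM T bk bk) (r := s).
  by move=> p /b0 ->; rewrite mulr0.
(* up to the factor eps, the components along x_i, y_i and z contribute M1, 2 M1
   and M3 + 2 M2, at most 5 M in all *)
pose M := M1 + M2 + M3; pose eps := (10 * M + 1)^-1.
have eps0 : 0 < eps by rewrite invr_gt0; rewrite /M; lra.
have eps1 : eps <= 1 by rewrite invf_le1 ?/M; lra.
have epsM : eps * (5 * M) <= 2^-1.
  have : eps * (10 * M + 1) = 1 by rewrite mulVf // gt_eqF // /M; lra.
  by lra.
have bound th (u v w d : R) : 0 <= d -> `|u| <= M1 * d -> `|v| <= M2 * d ->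
    `|w| <= M3 * d ->
    `|xyz (eps * u * sin th) (eps * u * (1 - cos th))
      (eps * (eps * w * (sin th * cos th) / 2 - v * (1 - cos th)))| <= 2^-1 * d.
  move=> d0 ud vd wd; apply: le_trans (normr_xyz_le _ _ _) _.
  have := sin_le1 th; have := sin_geN1 th; have := cos_le1 th; have := cos_geN1 th.
  set S := sin th; set C := cos th => C1 C2 S1 S2.
  have S3 : `|S| <= 1 by rewrite ler_norml S1.
  have C3 : `|C| <= 1 by rewrite ler_norml C1.
  have D3 : `|1 - C| <= 2 by rewrite ler_norml; lra.
  rewrite !normrM !(ger0_norm (ltW eps0)).
  have w3 : `|eps * w * (S * C) / 2 - v * (1 - C)| <= M3 * d + M2 * d * 2.
    rewrite (le_trans (ler_normB _ _)) // lerD //; last by rewrite normrM ler_pM.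
    rewrite !normrM (ger0_norm (ltW eps0)) normfV (ger0_norm (ler0n _ 2)).
    rewrite ler_pdivrMr //.
    apply: (@le_trans _ _ (1 * (M3 * d) * (1 * 1))).
      have a1 : eps * `|w| <= 1 * (M3 * d) by apply: ler_pM => //; exact: ltW.
      have a2 : `|S| * `|C| <= 1 * 1 by exact: ler_pM.
      apply: (ler_pM _ _ a1 a2); apply: mulr_ge0 => //; exact: ltW.
    by have := le_trans (normr_ge0 _) wd; lra.
  apply: (@le_trans _ _ (eps * (M1 * d) * 1 + eps * (M1 * d) * 2 + eps * (M3 * d + M2 * d * 2))).
    have a1 : eps * `|u| <= eps * (M1 * d) by rewrite ler_pM2l.
    have a0 : 0 <= eps * `|u| by apply: mulr_ge0 => //; exact: ltW.
    by apply: lerD; [apply: lerD; exact: ler_pM | rewrite ler_pM2l].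
  apply: (@le_trans _ _ (eps * (5 * M) * d)); last by rewrite ler_wpM2r.
  have m1 : 0 <= M1 * d by rewrite mulr_ge0.
  have m2 : 0 <= M2 * d by rewrite mulr_ge0.
  have m3 : 0 <= M3 * d by rewrite mulr_ge0.
  rewrite [leLHS](_ : _ = eps * (3 * (M1 * d) + 2 * (M2 * d) + M3 * d)); last by ring.
  by rewrite -mulrA ler_pM2l // /M; lra.
have twistE th p : twist eps s th p = xyz (eps * b p * sin th) (eps * b p * (1 - cos th))
    (eps * (eps * (b p * b p) * (sin th * cos th) / 2 - (X p * b p) * (1 - cos th))).
  by rewrite /twist /loop; congr xyz; rewrite -/b -/(X p); ring.
exists eps => // th; split=> [p|p q].
  rewrite twistE (le_trans (bound th _ _ _ 1 _ _ _ _)) ?mulr1 //.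
  by rewrite invf_le1 // ler1n.
rewrite !twistE xyzB.
have := bound th (b p - b q) (X p * b p - X q * b q) (b p * b p - b q * b q) `|p - q|
  (normr_ge0 _) (bl p q) (Xbl p q) (bbl p q).
by congr (_ <= _); congr (`| _ |); congr xyz; ring.
Qed.

End Loop.

(** * Velocities of paths of diffeomorphisms *)

Section PathCalculus.
Variables (R : realType).

(** Properness gives uniqueness of one-sided derivatives, including at the
    endpoints. *)
Lemma within01_proper (t : R) : t \in `[0, 1] ->
  ProperFilter (within `[0, 1]%classic t^').
Proof.
rewrite in_itv /= => /andP[t0 t1]; apply: Build_ProperFilter_ex => P.
rewrite /within /= => /nbhs_ballP[e /= e0 eP].
have [t2|t2] := ltP t 2^-1.
- pose s := t + Num.min (e / 2) 2^-1.
  have m0 : 0 < Num.min (e / 2) 2^-1 by rewrite lt_min invr_gt0 ltr0n divr_gt0.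
  exists s; apply: eP; rewrite /s.
  + rewrite -ball_normE /= opprD addrA subrr add0r normrN gtr0_norm //.
    by rewrite gt_min ltr_pdivrMr // ltr_pMr // ltr1n.
  + by rewrite gt_eqF // ltrDl.
  + have : Num.min (e / 2) 2^-1 <= 2^-1 by rewrite ge_min lexx orbT.
    by rewrite /= in_itv /=; lra.
- pose s := t - Num.min (e / 2) 2^-1.
  have m0 : 0 < Num.min (e / 2) 2^-1 by rewrite lt_min invr_gt0 ltr0n divr_gt0.
  exists s; apply: eP; rewrite /s.
  + rewrite -ball_normE /= opprB addrCA subrr addr0 gtr0_norm //.
    by rewrite gt_min ltr_pdivrMr // ltr_pMr // ltr1n.
  + by rewrite lt_eqF // gtrDl oppr_lt0.
  + have : Num.min (e / 2) 2^-1 <= 2^-1 by rewrite ge_min lexx orbT.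
    by rewrite /= in_itv /=; lra.
Qed.

Lemma is_derive_slope (W : normedModType R) (G : R -> W) (t : R) (dG : W) :
  is_derive t 1 G dG ->
  (s - t)^-1 *: (G s - G t) @[s --> within `[0, 1]%classic t^'] --> dG.
Proof.
move=> [Gd GE]; have : h^-1 *: (G (h *: 1 + t) - G t) @[h --> 0^'] --> dG.
  by rewrite -GE.
move=> /cvgrPdist_lt Gh; apply/cvgrPdist_lt => e e0.
have [d /= d0 dG'] := Gh e e0.
apply/nbhs_ballP; exists d => //= s; rewrite -ball_normE /= => st sNt _.
have := dG' (s - t); rewrite /ball_ /= sub0r opprB => /(_ st).
by rewrite subr_eq0 => /(_ sNt); rewrite [_ *: 1]mulr1 subrK.
Qed.

(** Around a point of [0, 1] x R^(2n+1), a path extends to a smooth map of an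
    open set; the partial derivatives of the extension compute the
    differentials of the path, and by [generates_ext] its velocity. *)
Lemma path_extension n (f : R -> Rstd R n -> Rstd R n) (t0 : R) p0 :
  diffeo_path f -> t0 \in `[0, 1] ->
  exists (U : set (R * Rstd R n)) (F : R * Rstd R n -> Rstd R n),
    [/\ open U, U (t0, p0), forall k, Ck_on k U F &
      forall t p, U (t, p) -> t \in `[0, 1] -> F (t, p) = f t p /\
        forall v, 'd (f t) p v = 'd F (t, p) (0, v)].
Proof.
move=> [fs fd] t01; have [U [F [Uo Up Fk Ff]]] := fs (t0, p0) t01.
exists U, F; split=> // t p Utp t01'; split=> [|v].
  by apply: Ff; rewrite inE.
have Fd : differentiable F (t, p) by have /Ck_onS[Fd _] := Fk 1%N; exact: Fd.
pose c (q : Rstd R n) := (t, q).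
have [cd cE] : is_diff p c (fun v => (0, v)).
  have [] := is_diff_pair (@is_diff_cst R _ R t p) (@is_diff_id R _ p).
  by move=> cd cE; split.
have Fcf : {near p, F \o c =1 f t}.
  have : nbhs p (c @^-1` U).
    apply: (@differentiable_continuous _ _ _ _ c cd).
    exact: open_nbhs_nbhs.
  by apply: filterS => q Uq /=; rewrite Ff // inE.
have [fdt ->] := near_eq_differentiable Fcf (differentiable_comp cd Fd).
by rewrite (diff_comp cd Fd) /= cE.
Qed.

Lemma generates_ext n (f X : R -> Rstd R n -> Rstd R n)
    (U : set (R * Rstd R n)) (F : R * Rstd R n -> Rstd R n) (t : R) p :
  generates f X -> open U -> (forall k, Ck_on k U F) ->
  (forall (s : R) q, U (s, q) -> s \in `[0, 1] -> F (s, q) = f s q) ->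
  U (t, p) -> t \in `[0, 1] -> X t (f t p) = 'd F (t, p) (1, 0).
Proof.
move=> gX Uo Fk Ff Up t01.
have Fd : differentiable F (t, p) by have /Ck_onS[Fd _] := Fk 1%N; exact: Fd.
pose c (s : R) := (s, p).
have [cd cE] : is_diff t c (fun v => (v, 0)).
  have [] := is_diff_pair (@is_diff_id R _ t) (@is_diff_cst R R _ p t).
  by move=> cd cE; split.
have dFc : is_derive t 1 (F \o c) ('d F (t, p) (1, 0)).
  have Fcd := differentiable_comp cd Fd.
  apply: DeriveDef; first exact: diff_derivable.
  by rewrite deriveE // (diff_comp cd Fd) /= cE.
have := within01_proper t01 => PF.
apply: (cvg_unique _ (gX t p t01)); first exact: norm_hausdorff.
have := is_derive_slope dFc; apply: cvg_trans; apply: near_eq_cvg.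
have : nbhs t (c @^-1` U).
  by apply: (differentiable_continuous cd); exact: open_nbhs_nbhs.
move=> /nbhs_ballP[d /= d0 Uc]; apply/nbhs_ballP; exists d => //= s sd _ s01.
rewrite !Ff //; exact: Uc.
Qed.

End PathCalculus.

(** * The conformal factor of a contactomorphism *)

Section ConformalFactor.
Variables (R : realType) (n : nat).
Implicit Types (p v : Rstd R n) (phi : Rstd R n -> Rstd R n).

Lemma alpha0_is_linear p : linear (alpha0 p).
Proof.
move=> a u v; rewrite /alpha0 !mxE scalerDr -addrACA; congr (_ + _).
rewrite scaler_sumr -big_split; apply: eq_bigr => j _ /=.
by rewrite !mxE mulrDr [_ *: _]mulrCA.
Qed.

HB.instance Definition _ p :=
  GRing.isLinear.Build _ _ _ _ (@alpha0 R n p) (@alpha0_is_linear p).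

(** The Reeb vector field of [alpha0]. *)
Definition reeb : Rstd R n := delta_mx 0 (iz n).

Lemma alpha0_reeb p : alpha0 p reeb = 1.
Proof.
rewrite /alpha0 big1 => [|j _]; first by rewrite !mxE !eqxx addr0.
by rewrite !mxE iy_neq_iz mulr0.
Qed.

Lemma Ck_on_alpha0 (V : normedModType R) k (U : set V) (P Q : V -> Rstd R n) :
  open U -> Ck_on k U P -> Ck_on k U Q -> Ck_on k U (fun x => alpha0 (P x) (Q x)).
Proof.
move=> Uo Pk Qk; apply: Ck_onD => //; first exact: Ck_on_coord.
by apply: Ck_on_sum => // j; apply: Ck_onM => //; exact: Ck_on_coord.
Qed.

Lemma smooth_on_setT_differentiable (V W : normedModType R) (f : V -> W) x :
  smooth_on setT f -> differentiable f x.
Proof.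
move=> fs; have [U [F [Uo Ux Fk FE]]] := fs x I.
have Ff : {near x, F =1 f}.
  have := open_nbhs_nbhs (conj Uo Ux).
  by apply: filterS => y Uy; apply: FE; rewrite inE.
have /Ck_onS[Fd _] := Fk 1%N.
exact: (near_eq_differentiable Ff (Fd _ Ux)).1.
Qed.

(** The factor [lambda] in [phi^* alpha0 = lambda * alpha0], read off by
    evaluating both sides on the Reeb field. *)
Definition conformal_factor phi p : R := alpha0 (phi p) ('d phi p reeb).

(** [v - alpha0 p v *: reeb] lies in the contact hyperplane, so its image does
    too. *)
Lemma alpha0_contacto phi p v : contactomorphism phi ->
  alpha0 (phi p) ('d phi p v) = conformal_factor phi p * alpha0 p v.
Proof.
move=> [_ cphi]; have w0 : alpha0 p (v - alpha0 p v *: reeb) = 0.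
  by rewrite linearB linearZ /= alpha0_reeb [_ *: _]mulr1 subrr.
have : xi0 (phi p) ('d phi p (v - alpha0 p v *: reeb)).
  by rewrite -cphi; exists (v - alpha0 p v *: reeb).
rewrite /xi0 /= linearB linearZ linearB linearZ /= => /eqP.
by rewrite subr_eq0 => /eqP ->; rewrite [LHS]mulrC.
Qed.

(** Otherwise the Reeb vector would have the same image as a vector of the
    contact hyperplane, against the injectivity of the differential. *)
Lemma conformal_factor_neq0 phi p : contactomorphism phi ->
  conformal_factor phi p != 0.
Proof.
move=> [[psi [phiK psiK phis psis]] cphi]; apply/eqP => c0.
have : xi0 (phi p) ('d phi p reeb) by [].
rewrite -cphi => -[w pw dw].
have phid := smooth_on_setT_differentiable p phis.
have psid := smooth_on_setT_differentiable (phi p) psis.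
have dK v : 'd psi (phi p) ('d phi p v) = v.
  have := diff_comp phid psid => /(congr1 (@^~ v)) /= <-.
  rewrite (_ : psi \o phi = id); last by apply/funext => q /=; rewrite phiK.
  by have [_ ->] := is_diff_id p.
have wr : w = reeb := etrans (esym (dK w)) (etrans (congr1 _ dw) (dK reeb)).
by move: pw; rewrite wr /xi0 /= alpha0_reeb => /eqP; rewrite oner_eq0.
Qed.

Lemma conformal_factor_id p : conformal_factor id p = 1.
Proof. by rewrite /conformal_factor; have [_ ->] := is_diff_id p; exact: alpha0_reeb. Qed.

(** The factor is [1] at the identity, and along a path of contactomorphisms it is
    continuous and never zero. *)
Lemma conformal_factor_gt0 phi p : Cont0 phi -> 0 < conformal_factor phi p.
Proof.
move=> [h [hp hc h0 h1]]; pose c s := conformal_factor (h s) p.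
have c_cont : {within `[0, 1], continuous c}.
  apply/subspace_continuousP => t t01.
  have [U [F [Uo Ut Fk FE]]] := path_extension p hp t01.
  pose L x := alpha0 (F x) ('d F x (0, reeb)).
  have Lk : Ck_on 0 U L.
    apply: Ck_on_alpha0 => //; have /Ck_onS[Fd dFk] := Fk 1%N.
    apply: Ck_on_ext (dFk (0, reeb)) => // x Ux; rewrite deriveE //; exact: Fd.
  have Lc s : U (s, p) -> s \in `[0, 1] -> L (s, p) = c s.
    by move=> Us s01; have [E dE] := FE s p Us s01; rewrite /L /c /conformal_factor E dE.
  pose i (s : R) := (s, p).
  have ic : i @ t --> (t, p).
    have [id_ _] := is_diff_pair (@is_diff_id R _ t) (@is_diff_cst R R _ p t).
    exact: (differentiable_continuous id_).
  suff : c s @[s --> within `[0, 1]%classic (nbhs t)] --> L (t, p).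
    by rewrite (Lc t Ut t01).
  have : L (i s) @[s --> within `[0, 1]%classic (nbhs t)] --> L (t, p).
    apply: cvg_within_filter.
    exact: (cvg_comp _ _ ic (Lk _ Ut)).
  apply: cvg_trans; apply: near_eq_cvg.
  have /nbhs_ballP[d /= d0 dU] : nbhs t (i @^-1` U) by apply: ic; exact: open_nbhs_nbhs.
  apply/nbhs_ballP; exists d => //= s sd s01.
  by apply: Lc => //; exact: dU.
have c0 : c 0 = 1 by rewrite /c h0 conformal_factor_id.
rewrite -h1 -/(c 1) ltNge; apply/negP => c1.
have c01 : Num.min (c 0) (c 1) <= 0 <= Num.max (c 0) (c 1).
  by rewrite c0 ge_min le_max c1 ler01 orbT.
have [t t01 ct] := IVT ler01 c_cont c01.
by have /(conformal_factor_neq0 p)/eqP := hc t t01.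
Qed.

End ConformalFactor.

(** * Bounds that are uniform in time *)

Section UniformBounds.
Variables (R : realType) (n : nat).
Implicit Types (f X : R -> Rstd R n -> Rstd R n).

(** For a property that is preserved when the bound [N] grows, local bounds on a
    compact set yield a global one. *)
Lemma compact_uniform_bound (T : topologicalType) (K : set T)
    (P : R -> T -> Prop) : compact K ->
  (forall x, K x -> exists N0, \forall x' \near x, K x' ->
     forall N, N0 <= N -> P N x') ->
  exists N, forall x, K x -> P N x.
Proof.
move=> /compact_near_coveringP/near_covering_withinP cK KP.
have cP x : K x -> \forall x' \near x & N \near pinfty_nbhs R, K x' -> P N x'.
  move=> Kx; have [N0 xN] := KP x Kx.
  exists ([set x' | K x' -> forall N, N0 <= N -> P N x'], [set N | N0 <= N]).
    by split=> //; apply: nbhs_pinfty_ge; exact: num_real.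
  by move=> [x' N] [/= h N0N] Kx'; exact: h.
have [N NP] := filter_ex (cK _ _ _ _ cP); by exists N.
Qed.

(** One step of Newton's method with frozen slope [L] for an equation in the
    second variable of [F]. *)
Lemma is_diff_newton_step (V W : normedModType R) (F : R * V -> W)
    (L : {linear W -> V}) (t : R) (w b : V) :
  differentiable F (t, w) -> continuous L ->
  is_diff w (fun p => p - L (F (t, p)) + b)
    (fun v => v - L ('d F (t, w) (0, v))).
Proof.
move=> Fd Lc; pose c (q : V) := (t, q).
have dc : is_diff w c (pair 0).
  have [] := is_diff_pair (@is_diff_cst R _ R t w) (@is_diff_id R _ w).
  by move=> cd cE; split.
have dL : is_diff (F (c w)) L L.
  by split; [exact: linear_differentiable | exact: diff_lin].
have dF : is_diff (c w) F ('d F (c w)) := differentiableP Fd.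
have dLFc := is_diff_comp (is_diff_comp dc dF) dL.
have dT := is_diffD (is_diffB (@is_diff_id R _ w) dLFc) (is_diff_cst b w).
rewrite (_ : (fun p => _) = id - (L \o (F \o c)) + cst b) //.
by apply: (is_diff_eq dT); apply/funext => v; rewrite !fctE addr0.
Qed.

(** Locally uniform boundedness of [f_t^-1 q] near [(t0, q0)] is the existence part
    of the implicit function theorem: for [(t, q)] close to [(t0, q0)], the
    equation [f_t p = q] has a solution close to [p0 = f_t0^-1 q0], as fixed point
    of a Newton step, and by injectivity of [f_t] it is the only solution
    anywhere. *)
Lemma preimages_bounded f (K : set (Rstd R n)) : diffeo_path f -> compact K ->
  exists r, forall (t : R) p, t \in `[0, 1] -> K (f t p) -> `|p| <= r.
Proof.
move=> fp cK; have [_ fd] := fp.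
pose P (N : R) (x : R * Rstd R n) := forall p, f x.1 p = x.2 -> `|p| <= N.
pose I01 : set R := `[0, 1]%classic.
have cIK : compact (I01 `*` K).
  by apply: compact_setX => //; exact: segment_compact.
suff [N NP] : exists N, forall x, (I01 `*` K) x -> P N x.
  by exists N => t p t01 Kfp; exact: (NP (t, f t p) (conj t01 Kfp) p erefl).
apply: compact_uniform_bound cIK _ => -[t0 q0] [/= t01 _].
have [psi [psiK fK fs psis]] := fd t0 t01.
pose p0 := psi q0; have fp0 : f t0 p0 = q0 by exact: fK.
have [U [F [Uo Up Fk FE]]] := path_extension p0 fp t01.
have [Fp0 dFp0] := FE _ _ Up t01.
have Fd x : U x -> differentiable F x by have /Ck_onS[h _] := Fk 1%N; exact: h.
have f0d : differentiable (f t0) p0 := smooth_on_setT_differentiable p0 fs.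
have psid : differentiable psi q0 := smooth_on_setT_differentiable q0 psis.
have f0d' : differentiable (f t0) (psi q0) by [].
have psid' : differentiable psi (f t0 p0) by rewrite fp0.
have [L [LA AL]] : exists L : {linear Rstd R n -> Rstd R n},
    cancel ('d (f t0) p0) L /\ cancel L ('d (f t0) p0).
  exists ('d psi q0); split=> v.
    have := diff_comp f0d psid' => /(congr1 (@^~ v)) /=; rewrite fp0 => <-.
    rewrite (_ : psi \o f t0 = id); last by apply/funext => q /=; rewrite psiK.
    by have [_ ->] := is_diff_id p0.
  have := diff_comp psid f0d' => /(congr1 (@^~ v)) /= <-.
  rewrite (_ : f t0 \o psi = id); last by apply/funext => q /=; rewrite fK.
  by have [_ ->] := is_diff_id q0.
have L_inj : injective L := can_inj AL.
have Lc : continuous L by exact: linear_rV_continuous.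
(* the fixed points p of T (t, q) solve F (t, p) = q, and Q i (t, p) is the i-th
   partial derivative of T (t, q) at p *)
pose T (x : R * Rstd R n) (p : Rstd R n) := p - L (F (x.1, p)) + L x.2.
pose Q i (x : R * Rstd R n) := delta_mx 0 i - L ('d F x (0, delta_mx 0 i)).
pose S x := \sum_i `|Q i x|.
have Sk : Ck_on 0 U S.
  have Qk i : Ck_on 0 U (Q i).
    have /Ck_onS[_ dFk] := Fk 1%N.
    have LDk := Ck_on_linear_comp Lc Uo (dFk (0, delta_mx 0 i)).
    have NLDk := Ck_onZ Uo (Ck_on_cst 0 U (-1 : R)) LDk.
    apply: Ck_on_ext Uo _ (Ck_onD Uo (Ck_on_cst 0 U (delta_mx 0 i)) NLDk) => x Ux.
    by rewrite /= scaleN1r (deriveE _ (Fd _ Ux)).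
  apply: Ck_on_sum => // i x Ux; apply: cvg_norm; exact: Qk.
have S0 : S (t0, p0) = 0.
  by apply: big1 => i _; rewrite /Q -dFp0 LA subrr normr0.
have [d d0 dS] : exists2 d : R, 0 < d & forall t p, `|t - t0| < d ->
    `|p - p0| < d -> U (t, p) /\ S (t, p) <= 2^-1.
  have U_S : nbhs (t0, p0) (U `&` [set x | S x < 2^-1]).
    apply: filterI; first exact: open_nbhs_nbhs.
    by apply: (cvgr_lt _ (Sk _ Up)); rewrite S0 invr_gt0.
  have /nbhs_ballP[d /= d0 dUS] := U_S; exists d => // t p td pd.
  have [|Utp Stp] := dUS (t, p).
    by split; rewrite -ball_normE /= distrC.
  by split=> //; exact: ltW.
pose e := d / 2; have e0 : 0 < e by rewrite divr_gt0.
pose E (x : R * Rstd R n) := L x.2 - L (F (x.1, p0)).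
have Ec : E x @[x --> (t0, q0)] --> E (t0, q0).
  apply: cvgB.
    exact: (Ck_on_linear_comp Lc openT (@Ck_on_snd R R (Rstd R n) 0 setT) (t0, q0) I).
  have cc : (fun x : R * Rstd R n => (x.1, p0)) x @[x --> (t0, q0)] --> (t0, p0).
    have := @Ck_on_pair R (R * Rstd R n)%type R (Rstd R n) 0 setT fst (cst p0) openT
      (@Ck_on_fst _ _ _ 0 _) (@Ck_on_cst _ _ _ 0 _ _).
    by move=> /(_ (t0, q0) I).
  exact: (cvg_comp _ _ cc (Ck_on_linear_comp Lc Uo (Fk 0%N) _ Up)).
have E0 : E (t0, q0) = 0 by rewrite /E /= Fp0 fp0 subrr.
exists (`|p0| + e).
have near_te : nbhs (t0, q0) [set x : R * Rstd R n | `|x.1 - t0| < d].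
  apply/nbhs_ballP; exists d => //= x [x1 _].
  by move: x1; rewrite -ball_normE /= distrC.
have near_E : nbhs (t0, q0) [set x | `|E x| < e / 2].
  have := Ec => /cvgrPdist_lt /(_ (e / 2)); rewrite divr_gt0 // => /(_ isT).
  by apply: filterS => x; rewrite E0 sub0r normrN.
near=> x => -[t01' _] N eN p' fp'.
have xd : `|x.1 - t0| < d by near: x; exact: near_te.
have xE : `|E x| < e / 2 by near: x; exact: near_E.
have [|||p pe pT] := @contraction_ball R (Rstd R n) (T x) p0 e.
- exact: ltW.
- move=> y z ye ze; rewrite distrC; rewrite [X in _ <= _ * X]distrC.
  apply: rV_lipschitz_segment => s /andP[s0 s1]; set w := _ + y.
  have [|Uw Sw] := dS x.1 w xd.
    apply: (@le_lt_trans _ _ e); last by rewrite /e ltr_pdivrMr // ltr_pMr // ltr1n.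
    rewrite (_ : w - p0 = s *: (z - p0) + (1 - s) *: (y - p0)); last first.
      by apply/rowP => k; rewrite !mxE; ring.
    apply: le_trans (ler_normD _ _) _; rewrite !normrZ !ger0_norm ?subr_ge0 //.
    have := ler_wpM2l s0 ze; rewrite -subr_ge0 in s1; have := ler_wpM2l s1 ye.
    by lra.
  have Tw : is_diff w (T x) (fun v => v - L ('d F (x.1, w) (0, v))).
    by apply: is_diff_newton_step => //; exact: Fd.
  have [Td TE] := Tw; split=> //.
  apply: le_trans (normr_derive_le _ Td) _; rewrite ler_wpM2r //.
  apply: le_trans Sw; apply: ler_sum => k _.
  by rewrite deriveE // TE.
- rewrite (_ : T x p0 - p0 = E x) ?ltW //.
  by rewrite /T /E; apply/rowP => k; rewrite !mxE; ring.
have [|Up' _] := dS x.1 p xd.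
  by apply: (le_lt_trans pe); rewrite /e ltr_pdivrMr // ltr_pMr // ltr1n.
have [Fp _] := FE _ _ Up' t01'.
have : F (x.1, p) = x.2.
  apply: L_inj; apply/eqP; rewrite -subr_eq0; apply/eqP.
  by move: pT => /(congr1 (fun z => p - z)); rewrite subrr /T opprD opprB addrA addrCA subrr addr0.
rewrite Fp -fp' => pp'; have [psi' [psi'K _ _ _]] := fd _ t01'.
have -> : p' = p by rewrite -(psi'K p') -pp' psi'K.
apply: le_trans eN; rewrite -(subrK p0 p) addrC (le_trans (ler_normD _ _)) //.
by rewrite lerD2l.
Unshelve. all: by end_near. Qed.

Lemma Cont0_contactomorphism (phi : Rstd R n -> Rstd R n) :
  Cont0 phi -> contactomorphism phi.
Proof.
by move=> [h [_ hc _ <-]]; apply: hc; rewrite in_itv /= ler01 lexx.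
Qed.

(** Both terms are locally restrictions of continuous functions of [(t, p)], and
    the conformal factor is positive. *)
Lemma speed_bounded_below f X r : contact_path f -> generates f X ->
  exists N : R, forall (t : R) p, t \in `[0, 1] -> `|p| <= r ->
    0 < alpha0 (f t p) (X t (f t p)) + N * conformal_factor (f t) p.
Proof.
move=> [fp fc] gX; pose I01 : set R := `[0, 1]%classic.
pose B := [set p : Rstd R n | `|p| <= r].
have cIB : compact (I01 `*` B).
  by apply: compact_setX; [exact: segment_compact | exact: normr_le_compact].
pose P (N : R) (x : R * Rstd R n) :=
  0 < alpha0 (f x.1 x.2) (X x.1 (f x.1 x.2)) + N * conformal_factor (f x.1) x.2.
suff [N NP] : exists N, forall x, (I01 `*` B) x -> P N x.
  by exists N => t p t01 pr; exact: (NP (t, p) (conj t01 pr)).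
apply: compact_uniform_bound cIB _ => -[t0 p0] [/= t01 _].
have [U [F [Uo Up Fk FE]]] := path_extension p0 fp t01.
have Fd x : U x -> differentiable F x by have /Ck_onS[h _] := Fk 1%N; exact: h.
pose A w x := alpha0 (F x) ('d F x w).
have Ak w : Ck_on 0 U (A w).
  apply: Ck_on_alpha0 => //; have /Ck_onS[_ dFk] := Fk 1%N.
  by apply: Ck_on_ext (dFk w) => // x Ux; rewrite deriveE //; exact: Fd.
pose a := A (1, 0); pose l := A (0, reeb R n).
have aE t p : U (t, p) -> t \in `[0, 1] -> a (t, p) = alpha0 (f t p) (X t (f t p)).
  move=> Utp tI; have [E _] := FE _ _ Utp tI; rewrite /a /A E.
  congr alpha0; apply/esym; apply: (generates_ext gX Uo Fk _ Utp tI).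
  by move=> s q Us sI; have [] := FE _ _ Us sI.
have lE t p : U (t, p) -> t \in `[0, 1] -> l (t, p) = conformal_factor (f t) p.
  by move=> Utp tI; have [E dE] := FE _ _ Utp tI; rewrite /l /A E -dE.
have l_gt0 t p : U (t, p) -> t \in `[0, 1] -> 0 < l (t, p).
  by move=> Utp tI; rewrite lE //; apply: conformal_factor_gt0; exact: fc.
have l0 := l_gt0 _ _ Up t01.
pose N0 := (1 + `|a (t0, p0)|) / l (t0, p0).
exists N0.
have bk : Ck_on 0 U (fun x => a x + N0 * l x).
  exact: Ck_onD Uo (Ak _) (Ck_onM Uo (Ck_on_cst 0 U N0) (Ak _)).
have b0 : 0 < a (t0, p0) + N0 * l (t0, p0).
  rewrite /N0 divfK ?gt_eqF //.
  by have := ler_norm (- a (t0, p0)); rewrite normrN; lra.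
have PN N x : N0 <= N -> x.1 \in `[0, 1] -> U x -> 0 < a x + N0 * l x -> P N x.
  case: x => t p /= N0N tI Utp; rewrite /P /= -(aE t p Utp tI) -(lE t p Utp tI).
  have := ler_wpM2r (ltW (l_gt0 t p Utp tI)) N0N.
  by move: (a (t, p)) (l (t, p)) => at_ lt_; lra.
near=> x => -[xI _] N N0N; apply: (PN N x N0N xI); near: x.
  exact: open_nbhs_nbhs.
exact: (cvgr_gt _ (bk _ Up)).
Unshelve. all: by end_near. Qed.

End UniformBounds.

(** * Absorbing the negative part of the speed *)

Theorem theorem1p2 (R : realType) (n : nat) (hn : (1 <= n)%N)
    (f : R -> Rstd R n -> Rstd R n) (K1 : set (Rstd R n))
    (hf : contact_path f) (hK1 : compact K1) (hpos : positive_on (~` K1) f) :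
  exists (g : R -> Rstd R n -> Rstd R n) (K2 : set (Rstd R n)),
    [/\ diffeo_path g, positive_on setT g, g 0 = f 0 & g 1 = f 1] /\
    [/\ compact K2, K1 `<=` K2 &
        forall (t : R) p, t \in `[0, 1] -> ~ K2 p -> g t p = f t p].
Proof.
have [fp fc] := hf; have [X gX Xpos] := hpos; have [fs fd] := fp.
pose i : 'I_n := Ordinal hn.
have [r1 rK1] : exists r, forall p, K1 p -> `|p| <= r.
  have [M [_ KM]] := compact_bounded hK1; exists (M + 1) => p Kp.
  by apply: KM Kp; rewrite ltrDl.
have [r rf] := preimages_bounded fp hK1.
(* phi_t displaces points by at most 1, so the bump has to be bounded below on the
   ball of radius r + 1 *)
pose a := `|r| + 1; pose s := (n + n).+1%:R * a ^+ 2 + 1.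
have a0 : 0 <= a by rewrite addr_ge0.
have s1 : 1 <= s by rewrite lerDr mulr_ge0 // sqr_ge0.
have [eps eps0 small] := twist_small i s1.
have [N NX] := speed_bounded_below r hf gX.
(* a lower bound for r ^ 2 / 2 on that ball, where the bump is at least exp (-1) *)
pose c := (eps * expR (- 1)) ^+ 2 / 2.
have c0 : 0 < c by rewrite divr_gt0 // exprn_gt0 // mulr_gt0 // expR_gt0.
have [k Nk] : exists k : nat, N <= (pi *+ 2 *+ k) * c.
  have pc : 0 < pi *+ 2 * c by rewrite mulr_gt0 // pmulrn_lgt0 // pi_gt0.
  exists (Num.truncn (N / (pi *+ 2 * c))).+1.
  rewrite -[_ *+ _.+1]mulr_natr mulrAC mulrC -ler_pdivrMr //.
  exact: ltW (truncnS_gt _).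
(* k full turns in unit time *)
pose kappa : R := pi *+ 2 *+ k.
have kappa0 : 0 <= kappa by rewrite mulrn_wge0 // mulrn_wge0 // pi_ge0.
pose phi (t : R) (p : Rstd R n) := p + twist i eps s (kappa * t) p.
pose g (t : R) p := f t (phi t p).
have TT := @openT (R * Rstd R n)%type.
have twk j := Ck_on_twist i eps s kappa j.
have phik j : Ck_on j setT (fun tp : R * Rstd R n => phi tp.1 tp.2).
  by apply: Ck_onD => //; exact: Ck_on_snd.
have slice t j (h : R * Rstd R n -> Rstd R n) : Ck_on j setT h ->
    Ck_on j setT (fun p => h (t, p)).
  move=> hk; have T2 := @openT (Rstd R n).
  apply: (Ck_on_comp (U' := setT) (g := fun p => (t, p)) (f := h)) => //.
    by apply: has_coordinates_prod; [exact: has_coordinates_real | exact: has_coordinates_rV].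
  by apply: Ck_on_pair => //; [exact: Ck_on_cst | exact: Ck_on_id].
have phi_diffeo t : diffeomorphism (phi t).
  have [|psi [phiK psiK psik]] :=
    @perturbed_id_diffeo R _ (twist i eps s (kappa * t)) _ (small (kappa * t)).2.
    by move=> j; exact: (slice t j _ (twk j)).
  exists psi; split=> //; first by apply: Ck_smooth_on => j; exact: (slice t j _ (phik j)).
  exact: Ck_smooth_on.
have g_diffeo t : t \in `[0, 1] -> diffeomorphism (g t).
  move=> t01; have [psi [fK fK' f_s psis]] := fd t t01.
  have [psi' [phiK phiK' phis psis']] := phi_diffeo t.
  exists (psi' \o psi); split.
  - by move=> p /=; rewrite /g fK phiK.
  - by move=> p /=; rewrite /g phiK' fK'.
  - by apply: (smooth_on_comp (A := setT)) => //; exact: has_coordinates_rV.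
  - by apply: (smooth_on_comp (A := setT)) => //; exact: has_coordinates_rV.
have g_path : diffeo_path g.
  split=> //.
  pose D := [set tp : R * Rstd R n | tp.1 \in `[0, 1]].
  have comp := @smooth_on_comp R _ _ _ D D (fun tp => f tp.1 tp.2)
    (fun tp => (tp.1, phi tp.1 tp.2)).
  apply: comp => //.
    by apply: has_coordinates_prod; [exact: has_coordinates_real | exact: has_coordinates_rV].
  by apply: Ck_smooth_on => j; apply: Ck_on_pair => //; exact: Ck_on_fst.
have [ginv gK] : exists ginv : R -> Rstd R n -> Rstd R n, forall t, t \in `[0, 1] ->
    cancel (g t) (ginv t) /\ cancel (ginv t) (g t).
  suff /choice[h hK] : forall t, exists psi, t \in `[0, 1] ->
    cancel (g t) psi /\ cancel psi (g t) by exists h.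
  move=> t; have [/g_diffeo[psi [? ? _ _]]|tN] := boolP (t \in `[0, 1]).
    by exists psi.
  by exists id.
pose rad (p : Rstd R n) := eps * bump s p.
pose v (t : R) (p : Rstd R n) :=
  kappa *: loop_velocity i (p ord0 (ix i)) (rad p) (kappa * t).
pose Y (t : R) p := X t (g t p) + 'd (f t) (phi t p) (v t p).
have gY : generates g (fun t q => Y t (ginv t q)).
  move=> t p t01; rewrite (gK t t01).1.
  have [U [F [Uo Ut Fk FE]]] := path_extension (phi t p) fp t01.
  have Fd : differentiable F (t, phi t p) by have /Ck_onS[h _] := Fk 1%N; exact: h.
  pose c' (u : R) := (u, phi u p).
  have [phid phiE] : is_derive t 1 (fun u : R => phi u p) (v t p).
    have := is_deriveD (is_derive_cst p t 1)
      (is_derive_loop i (p ord0 (ix i)) (rad p) kappa t).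
    by rewrite add0r.
  move/derivable1_diffP in phid.
  have [idd idE] := @is_diff_id R R t.
  have cd : differentiable c' t := differentiable_pair idd phid.
  have dG : is_derive t 1 (F \o c') (Y t p).
    have Gd := differentiable_comp cd Fd.
    apply: DeriveDef; first exact: diff_derivable.
    rewrite deriveE // (diff_comp cd Fd) /= (diff_pair idd phid).
    rewrite -(deriveE _ phid) phiE idE.
    rewrite (_ : (1, v t p) = (1, 0) + (0, v t p)); last first.
      by rewrite -[RHS]/(_, _) /= addr0 add0r.
    rewrite linearD /= -(FE _ _ Ut t01).2 /Y; congr (_ + _).
    apply/esym; apply: (generates_ext gX Uo Fk _ Ut t01).
    by move=> u q Uu uI; have [] := FE _ _ Uu uI.
  have := is_derive_slope dG; apply: cvg_trans; apply: near_eq_cvg.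
  have : nbhs t (c' @^-1` U).
    by apply: (differentiable_continuous cd); exact: open_nbhs_nbhs.
  move=> /nbhs_ballP[d /= d0 Uc]; apply/nbhs_ballP; exists d => //= u ud _ uI.
  by rewrite /c' (FE _ _ (Uc _ ud) uI).1 (FE _ _ Ut t01).1.
exists g, [set p | `|p| <= Num.max r1 s]; split; split=> //.
- exists (fun t q => Y t (ginv t q)) => // t q t01 _.
  set p := ginv t q; have qE : q = g t p by rewrite (gK t t01).2.
  rewrite qE /Y linearD /= (alpha0_contacto _ _ (Cont0_contactomorphism (fc t t01))).
  rewrite linearZ /= alpha0_loop_velocity -/(rad p) -[kappa *: _]/(kappa * _).
  have cf0 := conformal_factor_gt0 (phi t p) (fc t t01).
  set cf := conformal_factor _ _ in cf0 *.
  have rad2 : 0 <= rad p ^+ 2 / 2 by rewrite divr_ge0 // sqr_ge0.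
  have [Kq|nKq] := pselect (K1 (g t p)); last first.
    rewrite ltr_pwDl ?Xpos //.
    by apply: mulr_ge0; [exact: ltW | exact: mulr_ge0].
  have phir : `|phi t p| <= r by exact: rf Kq.
  have pa : `|p| <= a.
    have -> : `|p| = `|phi t p - twist i eps s (kappa * t) p| by rewrite addrK.
    rewrite (le_trans (ler_normB _ _)) // lerD //; last exact: (small _).1.
    exact: le_trans phir (ler_norm _).
  have bp : expR (- 1) <= bump s p by exact: (bump_ge a0).
  have radc : c <= rad p ^+ 2 / 2.
    rewrite ler_pM2r // ler_sqr ?nnegrE ?mulr_ge0 ?expR_ge0 ?(ltW eps0) //.
      by rewrite ler_pM2l.
    exact: le_trans (expR_ge0 _) bp.
  apply: lt_le_trans (NX t (phi t p) t01 phir) _.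
  rewrite lerD2l mulrC ler_pM2l // (le_trans Nk) // ler_wpM2l //.
- by apply/funext => p; rewrite /g /phi /twist mulr0 -(mulr0n (pi *+ 2)) loop_period addr0.
- by apply/funext => p; rewrite /g /phi /twist mulr1 loop_period addr0.
- exact: normr_le_compact.
- by move=> p /rK1 pr /=; rewrite le_max pr.
- move=> t p t01 /negP; rewrite -ltNge gt_max => /andP[_ sp].
  rewrite /g /phi /twist bump_support // mulr0 /loop /xyz.
  by rewrite !mul0r !scale0r !addr0.
Qed.
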